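(* Let $G$ be a simply connected Lie group with Lie algebra $\mathfrak{g}$, let $k^+$ be a left invariant flat pseudo-Riemannian metric on $G$, and let $\nabla$ be its Levi-Civita connection. Let $\nabla^H$ be the left invariant Hess connection on the Lie group $T^\ast G$ described in the context. Then $\nabla^H$ is geodesically complete if and only if $G$ is unimodular.
   Context: For $x\in\mathfrak{g}$ let $x^+$ be the associated left invariant vector field, put $L_x(y)=x\cdot y:=(\nabla_{x^+}y^+)(e)$, let $L^\ast_x(\alpha)=-\alpha\circ L_x$ be the dual representation of $\mathfrak{g}$ on $\mathfrak{g}^\ast$, and let $F:G\to\mathrm{GL}(\mathfrak{g}^\ast)$ be the Lie group homomorphism with differential $L^\ast$. The cotangent bundle $T^\ast G\approx G\times\mathfrak{g}^\ast$ is a Lie group with product $(g,\alpha)\cdot(g',\beta)=(gg',F(g)(\beta)+\alpha)$; its Lie algebra is $\mathfrak{g}\oplus\mathfrak{g}^\ast$ with bracket $[x+\alpha,y+\beta]_\ast=[x,y]+L^\ast_x(\beta)-L^\ast_y(\alpha)$. The Hess connection $\nabla^H$ is the left invariant connection on $T^\ast G$ given by $\nabla^H_{(x+\alpha)^+}(y+\beta)^+=(x\cdot y+L_x^\ast(\beta))^+$ for $x,y\in\mathfrak{g}$, $\alpha,\beta\in\mathfrak{g}^\ast$. *)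

(* Defs.v *)
From mathcomp Require Import all_boot all_order all_algebra.
From mathcomp Require Import all_classical all_reals all_analysis.

Set Implicit Arguments.
Unset Strict Implicit.
Unset Printing Implicit Defensive.

Import Order.TTheory GRing.Theory Num.Theory.
Import numFieldNormedType.Exports.

Local Open Scope classical_set_scope.
Local Open Scope ring_scope.

(** [smooth U f] is only meaningful for [U] open; the model spaces used below are
    finite dimensional. *)

Fixpoint Cn (R : realType) (E V : normedModType R) (k : nat)
    (U : set E) (f : E -> V) : Prop :=
  match k with
  | 0 => forall x, U x -> {for x, continuous f}
  | k'.+1 => (forall x, U x -> differentiable f x) /\
             (forall v : E, Cn k' U ('D_v f))
  end.

Definition smooth (R : realType) (E V : normedModType R)
    (U : set E) (f : E -> V) : Prop :=
  forall k, Cn k U f.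

(** Paths and homotopies are total functions of which only
    the restriction to the unit interval (square) matters. *)

Definition path_connected (R : realType) (T : topologicalType) : Prop :=
  forall x y : T, exists f : R -> T,
    [/\ {within `[0, 1], continuous f}, f 0 = x & f 1 = y].

Definition simply_connected (R : realType) (T : topologicalType) : Prop :=
  path_connected R T /\
  forall f : R -> T, {within `[0, 1], continuous f} -> f 0 = f 1 ->
    exists H : R * R -> T,
      [/\ {within `[0, 1] `*` `[0, 1], continuous H},
          (forall t, t \in `[0, 1] -> H (0, t) = f t),
          (forall t, t \in `[0, 1] -> H (1, t) = f 0) &
          (forall s, s \in `[0, 1] -> H (s, 0) = f 0 /\ H (s, 1) = f 0)].

(** Charts, given with their inverse; the values of [cmap] off [cdom] and of
    [cinv] off the image of [cdom] are irrelevant. *)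

Record chart (R : realType) (E : normedModType R) (T : topologicalType) :=
  Chart { cdom : set T; cmap : T -> E; cinv : E -> T }.

Definition cimg (R : realType) (E : normedModType R) (T : topologicalType)
    (c : chart E T) : set E := cmap c @` cdom c.

Definition is_chart (R : realType) (E : normedModType R) (T : topologicalType)
    (c : chart E T) : Prop :=
  [/\ open (cdom c), open (cimg c),
      (forall p, cdom c p -> cinv c (cmap c p) = p),
      (forall p, cdom c p -> {for p, continuous (cmap c)}) &
      (forall z, cimg c z -> {for z, continuous (cinv c)})].

(** The data of a Lie group modelled on [E]; the axioms are in [is_lie_group].
    The chart [chart1] at the identity identifies the tangent space at the
    identity, hence the Lie algebra, with [E]. *)

Record lieData (R : realType) (E : normedModType R) := LieData {
  carrier :> topologicalType;
  gone : carrier;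
  gmul : carrier -> carrier -> carrier;
  ginv : carrier -> carrier;
  atlas : set (chart E carrier);
  chart1 : chart E carrier }.

Arguments gone {R E} l.
Arguments atlas {R E} l _.
Arguments chart1 {R E} l.

Section LieGroup.
Variables (R : realType) (E : normedModType R) (G : lieData E).

Definition is_group : Prop :=
  [/\ (forall a b c : G, gmul a (gmul b c) = gmul (gmul a b) c),
      (forall a : G, gmul (gone G) a = a) &
      (forall a : G, gmul (ginv a) a = gone G)].

Definition is_smooth_manifold : Prop :=
  [/\ hausdorff_space G, @second_countable G,
      (forall c, atlas G c -> is_chart c),
      (forall p : G, exists2 c, atlas G c & cdom c p) &
      (forall c d, atlas G c -> atlas G d ->
         smooth (cmap c @` (cdom c `&` cdom d)) (cmap d \o cinv c))].

Definition mul_smooth : Prop :=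
  continuous (fun p : G * G => gmul p.1 p.2) /\
  forall a b c, atlas G a -> atlas G b -> atlas G c ->
    smooth [set z : E * E | [/\ cimg a z.1, cimg b z.2 &
                                cdom c (gmul (cinv a z.1) (cinv b z.2))]]
           (fun z : E * E => cmap c (gmul (cinv a z.1) (cinv b z.2))).

Definition inv_smooth : Prop :=
  continuous (@ginv _ _ G) /\
  forall a b, atlas G a -> atlas G b ->
    smooth [set z | cimg a z /\ cdom b (ginv (cinv a z))]
           (fun z => cmap b (ginv (cinv a z))).

Definition is_lie_group : Prop :=
  [/\ is_group, is_smooth_manifold,
      atlas G (chart1 G) /\ cdom (chart1 G) (gone G), mul_smooth & inv_smooth].

Definition smooth_on (V : normedModType R) (D : set G) (f : G -> V) : Prop :=
  forall c, atlas G c ->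
    smooth [set z | cimg c z /\ D (cinv c z)] (f \o cinv c).

(** [lderiv g x f] is [(x^+ f)(g)]: the derivative of [f] at [g] along the
    left translate to [g] of the tangent vector [x] at the identity. *)

Definition lderiv (V : normedModType R) (g : G) (x : E) (f : G -> V) : V :=
  'D_x (fun z => f (gmul g (cinv (chart1 G) z))) (cmap (chart1 G) (gone G)).

(** A vector field is recorded by its components [X : G -> E] in the left
    trivialisation [TG = G x E]: its value at [g] is the left translate of [X g].
    The left invariant field [x^+] is thus the constant function [cst x]. *)

Definition vfield (X : G -> E) : Prop := smooth_on setT X.

Definition sfun (f : G -> R) : Prop := smooth_on setT (f : G -> R^o).

Definition vact (X : G -> E) (f : G -> R) (g : G) : R :=
  lderiv g (X g) (f : G -> R^o).

(** [Z] is the Lie bracket of [X] and [Y]; local functions are used as test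
    functions. *)

Definition is_bracket (X Y Z : G -> E) : Prop :=
  forall (D : set G) (f : G -> R), open D -> smooth_on D (f : G -> R^o) ->
  forall g, D g -> vact Z f g = vact X (vact Y f) g - vact Y (vact X f) g.

(** Koszul connections; their values on fields that are not smooth are
    irrelevant. *)

Definition is_connection (nab : (G -> E) -> (G -> E) -> (G -> E)) : Prop :=
  [/\ (forall X Y, vfield X -> vfield Y -> vfield (nab X Y)),
      (forall X X' Y f, vfield X -> vfield X' -> vfield Y -> sfun f ->
         forall g, nab (fun h => f h *: X h + X' h) Y g =
                   f g *: nab X Y g + nab X' Y g),
      (forall X Y Y', vfield X -> vfield Y -> vfield Y' ->
         forall g, nab X (fun h => Y h + Y' h) g = nab X Y g + nab X Y' g) &
      (forall X Y f, vfield X -> vfield Y -> sfun f ->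
         forall g, nab X (fun h => f h *: Y h) g =
                   f g *: nab X Y g + vact X f g *: Y g)].

Definition torsion_free (nab : (G -> E) -> (G -> E) -> (G -> E)) : Prop :=
  forall X Y, vfield X -> vfield Y ->
    is_bracket X Y (fun g => nab X Y g - nab Y X g).

Definition flat (nab : (G -> E) -> (G -> E) -> (G -> E)) : Prop :=
  forall X Y Z W, vfield X -> vfield Y -> vfield Z -> vfield W ->
    is_bracket X Y W ->
    forall g, nab X (nab Y Z) g - nab Y (nab X Z) g - nab W Z g = 0.

(** [k] is a bilinear form on the Lie algebra; the left invariant metric [k^+]
    takes the value [k (X g) (Y g)] at [g] on the fields [X] and [Y]. *)

Definition metric_connection (k : E -> E -> R)
    (nab : (G -> E) -> (G -> E) -> (G -> E)) : Prop :=
  forall X Y Z, vfield X -> vfield Y -> vfield Z ->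
    forall g, vact X (fun h => k (Y h) (Z h)) g =
              k (nab X Y g) (Z g) + k (Y g) (nab X Z g).

Definition is_levi_civita (k : E -> E -> R)
    (nab : (G -> E) -> (G -> E) -> (G -> E)) : Prop :=
  [/\ is_connection nab, torsion_free nab & metric_connection k nab].

(** The curve [c] has velocity [u t], left translated to [c t], at time [t]. *)

Definition has_velocity (c : R -> G) (u : R -> E) : Prop :=
  continuous c /\
  forall (t : R) a, atlas G a -> cdom a (c t) ->
    is_derive t (1 : R) (cmap a \o c) (lderiv (c t) (u t) (cmap a)).

(** Writing [c' = sum_i u_i e_i^+] along [c], for a basis [(e_i)] of the Lie
    algebra, the covariant derivative of [c'] along [c] at time [t] is
    [sum_i u_i'(t) e_i^+ + sum_(i,j) u_i(t) u_j(t) nab_(e_i^+) e_j^+]; the double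
    sum is [nab] applied to the left invariant field [(u t)^+], twice. *)

Definition covariant_acceleration (nab : (G -> E) -> (G -> E) -> (G -> E))
    (c : R -> G) (u : R -> E) (t : R) : E :=
  'D_(1 : R) u t + nab (cst (u t)) (cst (u t)) (c t).

Definition is_geodesic (nab : (G -> E) -> (G -> E) -> (G -> E))
    (c : R -> G) (u : R -> E) : Prop :=
  [/\ has_velocity c u, (forall t, derivable u t (1 : R)) &
      (forall t, covariant_acceleration nab c u t = 0)].

Definition geodesically_complete
    (nab : (G -> E) -> (G -> E) -> (G -> E)) : Prop :=
  forall (p : G) (v : E), exists (c : R -> G) (u : R -> E),
    [/\ is_geodesic nab c u, c 0 = p & u 0 = v].

(** The differential at the identity of the conjugation by [g]. *)

Definition Ad (g : G) (x : E) : E :=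
  'D_x (fun z => cmap (chart1 G)
                   (gmul (gmul g (cinv (chart1 G) z)) (ginv g)))
       (cmap (chart1 G) (gone G)).

End LieGroup.

(** The modular function of a Lie group is [g |-> |det (Ad g)|], up to
    inversion of [g]. *)

Definition unimodular (R : realType) (n : nat) (G : lieData 'rV[R]_n) : Prop :=
  forall g : G, `|\det (lin1_mx (Ad g))| = 1.

Definition bilin (R : realType) (n : nat) (K : 'M[R]_n) (x y : 'rV[R]_n) : R :=
  (x *m K *m y^T) 0 0.

(** The Lie algebra is ['rV_n] and its dual is ['cV_n], the column [a] standing
    for the form [y |-> y *m a]. With [lin1_mx f] the matrix such that
    [y *m lin1_mx f = f y], the form [- a \o Lmul nab x] is [Lstar nab x *m a]. *)

Section Hess.
Variables (R : realType) (n : nat) (G : lieData 'rV[R]_n).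

Definition Lmul (nab : (G -> 'rV[R]_n) -> (G -> 'rV[R]_n) -> (G -> 'rV[R]_n))
    (x y : 'rV[R]_n) : 'rV[R]_n :=
  nab (cst x) (cst y) (gone G).

Definition Lstar (nab : (G -> 'rV[R]_n) -> (G -> 'rV[R]_n) -> (G -> 'rV[R]_n))
    (x : 'rV[R]_n) : 'M[R]_n :=
  - lin1_mx (Lmul nab x).

Definition is_rep_integrating (F : G -> 'M[R]_n) (L : 'rV[R]_n -> 'M[R]_n)
    : Prop :=
  [/\ (forall g, F g \in unitmx),
      (forall g h, F (gmul g h) = F g *m F h),
      smooth_on setT F &
      (forall x, lderiv (gone G) x F = L x)].

Definition cotangent_chart (c : chart 'rV[R]_n G) :
    chart ('rV[R]_n * 'cV[R]_n)%type (G * 'cV[R]_n)%type :=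
  Chart (cdom c `*` setT)
        (fun p => (cmap c p.1, p.2)) (fun z => (cinv c z.1, z.2)).

Definition cotangent (F : G -> 'M[R]_n) :
    lieData ('rV[R]_n * 'cV[R]_n)%type :=
  @LieData R ('rV[R]_n * 'cV[R]_n)%type (G * 'cV[R]_n)%type
    (gone G, 0)
    (fun p q => (gmul p.1 q.1, F p.1 *m q.2 + p.2))
    (fun p => (ginv p.1, - (F (ginv p.1) *m p.2)))
    (cotangent_chart @` atlas G)
    (cotangent_chart (chart1 G)).

Definition is_hess_connection (F : G -> 'M[R]_n)
    (nab : (G -> 'rV[R]_n) -> (G -> 'rV[R]_n) -> (G -> 'rV[R]_n))
    (nabH : (cotangent F -> 'rV[R]_n * 'cV[R]_n) ->
            (cotangent F -> 'rV[R]_n * 'cV[R]_n) ->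
            (cotangent F -> 'rV[R]_n * 'cV[R]_n)) : Prop :=
  is_connection nabH /\
  forall (x y : 'rV[R]_n) (a b : 'cV[R]_n),
    nabH (cst (x, a)) (cst (y, b)) = cst (Lmul nab x y, Lstar nab x *m b).

End Hess.

(* Main.v *)
Require Import Defs.
From HB Require Import structures.
From mathcomp Require Import all_boot all_order all_algebra.
From mathcomp Require Import all_classical all_reals all_analysis.
From mathcomp Require Import perm ring lra.
Import Order.TTheory GRing.Theory Num.Theory.
Import numFieldNormedType.Exports.
Set Implicit Arguments.
Unset Strict Implicit.
Unset Printing Implicit Defensive.
Local Open Scope classical_set_scope.
Local Open Scope ring_scope.

(** Write [x . y] for the product [nabla_x y] on the Lie algebra and
    [L_x y = x . y = R_y x].  Operators are composed from right to left in this
    comment; below, matrices act on row vectors, in the opposite order.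

    A geodesic of the Hess connection over a curve [c] has velocity [(u, a)]
    with [u' = - u . u] and [a' = L_u a].  The second equation is linear and is
    solved by [a = F(c)^-1 b], so only the Euler equation [u' = - u . u] can fail
    to have global solutions.  Since [L_x] is skew for the metric, the trace of
    [ad_x = L_x - R_x] is [- tr R_x]; as [G] is connected, it is unimodular if and
    only if [tr R_x = 0] for all [x] ([unimodular_trace], [trace_unimodular]).
    It remains to relate the Euler equation to these traces.

    The bridge is the orbit map of the affine action of [G] defined by [nabla],
    in which geodesics are straight lines.  Let [Q] be the representation of [G]
    with differential [L], dual to [F].  If [c] starts at the identity with a
    left velocity [u] solving the Euler equation, then [u = Q(c)^-1 v] with [v = u(0)],
    and [T = Q(c) Ad(c)^-1] satisfies [T' = R_v], so that [T = 1 + t R_v].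

    If all geodesics are complete, then [T] exists at time 1, so every [1 + R_v]
    is invertible ([complete_trace]).  This forces [tr R_e = 0]
    ([trace_Rm_eq0]): along an integral curve [y] of the affine field
    [y |-> e + e . y], the function [q = det (1 + R_y)] satisfies
    [q' = tr(R_e) q]; by Fitting's decomposition of [L_e] one of these integral
    curves is polynomial in [t], and a nonzero polynomial [q] satisfies such an
    equation only when [tr R_e = 0].

    Conversely, if all traces vanish then [det (1 + t R_v) = 1] for all [t]
    ([det_1DRm]), because its logarithmic derivative is [tr R_w] with
    [w = (1 + t R_v)^-1 v].  Hence [w] is defined for all times, and it is the
    right translated velocity of the curve looked for.  Differential equations
    on [G] with prescribed right velocity have global solutions ([right_flow]):
    in the chart at the identity the Picard-Lindelof theorem gives a time of
    existence that depends only on a bound on [w], and solutions can be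
    right translated and glued.  The left velocity of the solution then satisfies
    the Euler equation ([Euler_solution]).

    Two facts tie the analysis on [G] to the product.  The derivative at the
    identity of the adjoint representation is the bracket of left invariant
    fields, by the symmetry of the second derivatives of the multiplication
    ([adM_bracket]), and it is therefore [x . y - y . x] as [nabla] is torsion
    free.  The product is left symmetric because [F] is a representation
    ([Lmul_lsa]). *)

(** * Calculus of matrix valued functions *)

Section MatrixCalculus.
Variables (R : realType) (V : normedModType R).

Lemma is_derive_mxP m n (M : V -> 'M[R]_(m, n)) (t v : V) (M' : 'M[R]_(m, n)) :
  is_derive t v M M' <->
  forall i j, is_derive t v (fun x => M x i j : R^o) (M' i j : R^o).
Proof.
split=> [[dM <-] i j|dM].
  split; first exact: ((derivable_mxP M t v).1 dM).
  by rewrite derive_mx // mxE.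
have dM' : derivable M t v by apply/derivable_mxP => i j; case: (dM i j).
split=> //; rewrite derive_mx //; apply/matrixP => i j; rewrite mxE.
by case: (dM i j).
Qed.

Lemma is_derive_mulmx m n p (A : V -> 'M[R]_(m, n)) (B : V -> 'M[R]_(n, p))
    (t v : V) A' B' :
  is_derive t v A A' -> is_derive t v B B' ->
  is_derive t v (fun x => A x *m B x) (A' *m B t + A t *m B').
Proof.
move=> /is_derive_mxP dA /is_derive_mxP dB; apply/is_derive_mxP => i j.
rewrite (_ : (fun x => _) = \sum_k ((fun x => A x i k : R^o) * (fun x => B x k j : R^o))).
  apply: (is_derive_eq (is_derive_sum (fun k => is_deriveM (dA i k) (dB k j)))).
  rewrite !mxE -big_split; apply: eq_bigr => k _ /=.
  by rewrite [RHS]addrC; congr (_ + _); exact: mulrC.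
by apply/funext => x; rewrite mxE fct_sumE.
Qed.

Lemma is_derive_prod (I : finType) (f : I -> V -> R^o) (t v : V) (f' : I -> R^o) :
  (forall i, is_derive t v (f i) (f' i)) ->
  is_derive t v (fun x => \prod_i f i x : R^o)
    (\sum_i f' i * \prod_(j | j != i) f j t).
Proof.
move=> df.
have H (s : seq I) : uniq s -> is_derive t v (fun x => \prod_(i <- s) f i x : R^o)
    (\sum_(i <- s) f' i * \prod_(j <- s | j != i) f j t).
  elim: s => [|a s IH] /=.
    move=> _; rewrite big_nil (_ : (fun x => _) = cst 1); first exact: is_derive_cst.
    by apply/funext => x; rewrite big_nil.
  move=> /andP[as_ us].
  rewrite (_ : (fun x => _) = f a * (fun x => \prod_(i <- s) f i x)); last first.
    by apply/funext => x; rewrite big_cons.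
  apply: (is_derive_eq (is_deriveM (df a) (IH us))).
  rewrite !big_cons eqxx /= addrC; congr (_ + _).
    rewrite [LHS]mulrC; congr (_ * _); rewrite -!(big_map (fun i => f i t) xpredT idfun) /=.
    rewrite !big_map big_seq_cond [RHS]big_seq_cond; apply: eq_bigl => i.
    by case: eqVneq => [->|]; rewrite ?(negbTE as_) ?andbT.
  rewrite scaler_sumr !big_seq; apply: eq_bigr => i si.
  rewrite big_cons ifT; last by apply: contraNneq as_ => ->.
  by rewrite [LHS]mulrCA.
exact: H (index_enum_uniq I).
Qed.

(** Differentiating the Leibniz expansion gives the sum over [i] of the
    determinants of [A t] with row [i] replaced by row [i] of [A']; expanding each
    of them along that row produces the cofactors. *)
Lemma is_derive_det n (A : V -> 'M[R]_n) (t v : V) A' :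
  is_derive t v A A' ->
  is_derive t v (fun x => \det (A x) : R^o) (\tr (A' *m \adj (A t))).
Proof.
move=> /is_derive_mxP dA.
rewrite (_ : (fun x => _) = \sum_(s : 'S_n) (-1) ^+ s *: (fun x => \prod_i A x i (s i) : R^o)); last first.
  by apply/funext => x; rewrite fct_sumE.
have -> : \tr (A' *m \adj (A t)) = \sum_(s : 'S_n) (-1) ^+ s *: 
    (\sum_i A' i (s i) * \prod_(j | j != i) A t j (s j)).
  transitivity (\sum_i \det (\matrix_(j, k) if j == i then A' i k else A t j k)).
    rewrite /mxtrace; apply: eq_bigr => i _; rewrite (expand_det_row _ i) mxE.
    apply: eq_bigr => k _; rewrite !mxE eqxx; congr (_ * _).
    rewrite /cofactor; congr (_ * \det _); apply/matrixP => j l; rewrite !mxE.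
    by rewrite eq_sym (negbTE (neq_lift _ _)).
  rewrite exchange_big /=; apply: eq_bigr => s _; rewrite -scaler_sumr.
  congr (_ *: _); apply: eq_bigr => i _; rewrite (bigD1 i) //= mxE eqxx.
  by congr (_ * _); apply: eq_bigr => j /negbTE ji; rewrite mxE ji.
have : forall s : 'S_n, is_derive t v (fun x => \prod_i A x i (s i) : R^o) 
   (\sum_i A' i (s i) * \prod_(j | j != i) A t j (s j)).
  by move=> s; apply: (@is_derive_prod _ (fun i x => A x i (s i) : R^o)).
move=> H; elim/big_ind2 : _ => // [|f f' g g' Hf Hg|s _].
- exact: is_derive_cst.
- exact: is_deriveD.
- exact: is_deriveZ.
Qed.

(** Differentiability comes from the adjugate formula; the value then follows by
    differentiating [A x *m invmx (A x) = 1]. *)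
Lemma is_derive_invmx n (A : V -> 'M[R]_n) (t v : V) A' :
  (forall x, A x \in unitmx) -> is_derive t v A A' ->
  is_derive t v (fun x => invmx (A x)) (- (invmx (A t) *m A' *m invmx (A t))).
Proof.
move=> Au dA.
have dI : derivable (fun x => invmx (A x)) t v.
  rewrite (_ : (fun x => _) = (fun x => (\det (A x))^-1 *: \adj (A x))); last first.
    by apply/funext => x; rewrite /invmx Au.
  apply/derivable_mxP => i j; under eq_fun do rewrite !mxE.
  have dd : derivable (fun x => (\det (A x))^-1 : R^o) t v.
    apply: derivableV; first by have := Au t; rewrite unitmxE unitfE.
    by case: (is_derive_det dA).
  apply: (derivableM dd); apply: (derivableM (f := cst _)) => //.
  have dm : is_derive t v (fun x => row' j (col' i (A x))) (row' j (col' i A')).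
    apply/is_derive_mxP => k l; under eq_fun do rewrite !mxE.
    by rewrite !mxE; move/is_derive_mxP : dA.
  by case: (is_derive_det dm).
split=> //.
have /(@is_derive_mulmx _ _ _ _ _ _ _ _ _ dA) dAI := derivableP dI.
have : is_derive t v (fun x => A x *m invmx (A x)) 0.
  rewrite (_ : (fun x => _) = cst 1%:M); first exact: is_derive_cst.
  by apply/funext => x; rewrite mulmxV.
case=> _; case: dAI => _ -> /(congr1 (mulmx (invmx (A t)))).
rewrite mulmxDr !mulmxA mulVmx // mul1mx mulmx0 => /eqP.
by rewrite addrC addr_eq0 => /eqP.
Qed.

End MatrixCalculus.

Lemma cst_of_deriv0 (R : realType) (f : R -> R^o) :
  (forall t, is_derive t (1 : R) f 0) -> forall t, f t = f 0.
Proof.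
move=> df.
have cf a b : {within `[a, b], continuous f}.
  apply: continuous_subspaceT => x; apply/differentiable_continuous/derivable1_diffP.
  by case: (df x).
have H a b : a <= b -> f a = f b.
  move=> ab; have [c _] := @MVT_segment R f (fun=> 0) a b ab (fun x _ => df x) (cf a b).
  by rewrite mul0r => /eqP; rewrite subr_eq0 => /eqP ->.
by move=> t; case: (leP 0 t) => [/H ->|/ltW/H ->].
Qed.

Lemma mx_cst_of_deriv0 (R : realType) m n (f : R -> 'M[R]_(m, n)) :
  (forall t, is_derive t (1 : R) f 0) -> forall t, f t = f 0.
Proof.
move=> df t; apply/matrixP => i j.
apply: (@cst_of_deriv0 R (fun x => f x i j)) => s.
by have /is_derive_mxP/(_ i j) := df s; rewrite mxE.
Qed.

(** * Left symmetric algebras *)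

Lemma mul_rV_lin1P (R : realType) m n (f : 'rV[R]_m -> 'rV[R]_n) :
  (forall a x y, f (a *: x + y) = a *: f x + f y) ->
  forall x, x *m lin1_mx f = f x.
Proof.
move=> f_lin x; have lf : linear f by [].
pose fM := GRing.isLinear.Build _ _ _ _ f lf.
pose fL : {linear _ -> _} := HB.pack f fM.
exact: (mul_rV_lin1 fL).
Qed.

Lemma poly_eq0_horner (R : realType) (p : {poly R}) :
  (forall t, p.[t] = 0) -> p = 0.
Proof.
move=> p0; apply/eqP/negPn/negP => pn0.
pose rs : seq R := [seq i%:R | i <- iota 0 (size p)].
have urs : uniq rs.
  by rewrite map_inj_uniq ?iota_uniq // => i j /eqP; rewrite eqr_nat => /eqP.
have rrs : all (root p) rs by apply/allP => x _; rewrite rootE p0.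
by have := max_poly_roots pn0 rrs urs; rewrite size_map size_iota ltnn.
Qed.

(** The ranks of the powers of [L] cannot decrease more than [n] times. *)
Lemma mx_pow_stable (F : fieldType) n (L : 'M[F]_n) :
  exists k (D : 'M[F]_n), L ^+ k = D *m L ^+ k.+1.
Proof.
apply: contrapT => nex.
have H k : (\rank (L ^+ k) + k <= n)%N.
  elim: k => [|k IH]; first by rewrite addn0 rank_leq_row.
  apply: leq_trans IH; rewrite addnS ltn_add2r ltnNge; apply/negP => le.
  have sub : (L ^+ k.+1 <= L ^+ k)%MS by rewrite exprS submxMl.
  have /eqmxP : (L ^+ k.+1 == L ^+ k)%MS by rewrite -(geq_leqif (mxrank_leqif_eq sub)).
  move=> E; have : (L ^+ k <= L ^+ k.+1)%MS by rewrite E.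
  by move=> /submxP[D ED]; apply: nex; exists k, D.
by have := leq_trans (leq_addl _ _) (H n.+1); rewrite ltnn.
Qed.

Lemma commutator_regroup (V : zmodType) (A B C D E : V) :
  A + (C - D + B) = A + B + (E + C) - (E + D).
Proof.
by rewrite opprD -[RHS]addrA (addrACA E) subrr add0r -[RHS]addrA; congr (_ + _); rewrite addrC.
Qed.

Section LeftSymmetric.
Variables (R : realType) (n : nat) (pr : 'rV[R]_n -> 'rV[R]_n -> 'rV[R]_n).
Hypothesis prl : forall a x y z, pr (a *: x + y) z = a *: pr x z + pr y z.
Hypothesis prr : forall a x y z, pr x (a *: y + z) = a *: pr x y + pr x z.
Hypothesis lsa : forall x y z,
  pr x (pr y z) - pr y (pr x z) = pr (pr x y - pr y x) z.

(** Matrices act on row vectors from the right, so that [Lm x *m Lm y] is the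
    multiplication by [x] followed by that by [y]. *)
Definition Lm x : 'M[R]_n := lin1_mx (pr x).
Definition Rm y : 'M[R]_n := lin1_mx (pr^~ y).

Lemma mul_Lm x y : y *m Lm x = pr x y.
Proof. by apply: mul_rV_lin1P => a u v; exact: prr. Qed.

Lemma mul_Rm x y : x *m Rm y = pr x y.
Proof. by apply: (mul_rV_lin1P (f := pr^~ y)) => a u v; exact: prl. Qed.

Lemma Rm_lin a x y : Rm (a *: x + y) = a *: Rm x + Rm y.
Proof.
by apply/row_matrixP => i; rewrite !rowE mulmxDr -scalemxAr !mul_Rm prr.
Qed.

Lemma RmD x y : Rm (x + y) = Rm x + Rm y.
Proof. by have := Rm_lin 1 x y; rewrite !scale1r. Qed.

Lemma Rm0 : Rm 0 = 0.
Proof. by have := RmD 0 0; rewrite addr0 => /eqP; rewrite -subr_eq0 opprD addrA subrr sub0r oppr_eq0 => /eqP. Qed.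

Lemma RmZ a x : Rm (a *: x) = a *: Rm x.
Proof. by have := Rm_lin a x 0; rewrite Rm0 !addr0. Qed.

(** Left symmetry, read as an identity between operators in its middle
    argument. *)
Lemma Rm_Lm_comm x y :
  Rm y *m Lm x - Lm x *m Rm y = Rm (pr x y) - Rm x *m Rm y.
Proof.
apply/row_matrixP => i; rewrite !rowE !mulmxBr !mulmxA.
move: (delta_mx 0 i : 'rV[R]_n) => z.
rewrite !mul_Rm !mul_Lm.
have := lsa x z y.
have -> : pr (pr x z - pr z x) y = pr (pr x z) y - pr (pr z x) y.
  by rewrite addrC -scaleN1r prl scaleN1r addrC.
move/eqP; rewrite subr_eq => /eqP ->.
by rewrite addrAC addrC [X in _ + X]addrAC subrr sub0r.
Qed.

Lemma is_derive_Rm (V : normedModType R) (y : V -> 'rV[R]_n) (t v : V) y' :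
  is_derive t v y y' -> is_derive t v (fun s => Rm (y s)) (Rm y').
Proof.
move=> dy; apply/is_derive_mxP => i j.
have E z : Rm z i j = (z *m Lm (delta_mx 0 i)) 0 j.
  by rewrite mul_Lm -mul_Rm -rowE !mxE.
rewrite E; under eq_fun do rewrite E.
have := is_derive_mulmx dy (is_derive_cst (Lm (delta_mx 0 i)) t v).
by rewrite mulmx0 addr0 => /is_derive_mxP /(_ 0 j).
Qed.

Lemma is_derive_Lm (V : normedModType R) (y : V -> 'rV[R]_n) (t v : V) y' :
  is_derive t v y y' -> is_derive t v (fun s => Lm (y s)) (Lm y').
Proof.
move=> dy; apply/is_derive_mxP => i j.
have E z : Lm z i j = (z *m Rm (delta_mx 0 i)) 0 j.
  by rewrite mul_Rm -mul_Lm -rowE !mxE.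
rewrite E; under eq_fun do rewrite E.
have := is_derive_mulmx dy (is_derive_cst (Rm (delta_mx 0 i)) t v).
by rewrite mulmx0 addr0 => /is_derive_mxP /(_ 0 j).
Qed.

(** With [S = 1 + t Rm v] and [w *m S = v]: up to the commutator of [S] with
    [Lm w], multiplying [S] on the left by [Rm w] gives its derivative [Rm v]. *)
Lemma Rm_split t v w : w + t *: pr w v = v ->
  Rm v = (1%:M + t *: Rm v) *m Lm w - Lm w *m (1%:M + t *: Rm v)
         + Rm w *m (1%:M + t *: Rm v).
Proof.
move=> wv; rewrite -{1}wv RmD RmZ !mulmxDl !mulmxDr !mul1mx !mulmx1.
rewrite -!scalemxAl -!scalemxAr.
have /eqP := Rm_Lm_comm w v; rewrite eq_sym subr_eq => /eqP ->.
rewrite !scalerDr scalerN opprD.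
set A := t *: (Rm v *m Lm w); set B := t *: (Lm w *m Rm v).
set C := t *: (Rm w *m Rm v).
by rewrite [X in _ = X + _]addrACA subrr add0r addrCA.
Qed.

Section TraceZero.
Hypothesis trR0 : forall x, \tr (Rm x) = 0.

(** Where the determinant does not vanish, its logarithmic derivative is
    [\tr (Rm w)] with [w = v *m invmx (1 + t Rm v)], because a term
    [S *m L *m invmx S - L] has trace zero. *)
Lemma det_1DRm v t : \det (1%:M + t *: Rm v) = 1.
Proof.
pose S (t : R) := 1%:M + t *: Rm v.
have dS s : is_derive s (1 : R) S (Rm v).
  apply/is_derive_mxP => i j.
  rewrite (_ : (fun x => _) = cst (1%:M i j) + (Rm v i j : R^o) *: id); last first.
    by apply/funext => x; rewrite !mxE [X in _ + X]mulrC.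
  apply: (is_derive_eq (is_deriveD _ _)).
  by rewrite add0r [LHS]mulr1.
have tr0 s : \det (S s) != 0 -> \tr (Rm v *m \adj (S s)) = 0.
  move=> p0; have Su : S s \in unitmx by rewrite unitmxE unitfE.
  pose w := v *m invmx (S s).
  have wS : w + s *: pr w v = v.
    have : w *m S s = v by rewrite /w mulmxKV.
    by rewrite mulmxDr mulmx1 -scalemxAr mul_Rm.
  have Rv := Rm_split wS; rewrite -/(S s) in Rv.
  have adjE : \adj (S s) = \det (S s) *: invmx (S s).
    by rewrite /invmx Su scalerA divff // scale1r.
  rewrite adjE -scalemxAr mxtraceZ Rv mulmxDl mulmxBl.
  rewrite !mulmxK // !linearD linearN /=.
  by rewrite mxtrace_mulC mulKmx // subrr add0r trR0 mulr0.
(* The square has derivative zero also at possible zeros of the determinant;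
   being constant, it excludes them. *)
have p2 s : \det (S s) ^+ 2 = 1.
  have d2 r : is_derive r (1 : R) (fun x => \det (S x) ^+ 2 : R^o) 0.
    apply: (is_derive_eq (is_deriveX 2 (is_derive_det (dS r)))).
    have [p0|p0] := eqVneq (\det (S r)) 0; last by rewrite tr0 // scaler0.
    by rewrite p0 expr1 mulr0 scale0r.
  by rewrite (cst_of_deriv0 d2) /S scale0r addr0 det1 expr1n.
have pn0 s : \det (S s) != 0.
  by apply: contra_eqN (p2 s) => /eqP ->; rewrite expr0n eq_sym oner_eq0.
have dp r : is_derive r (1 : R) (fun x => \det (S x) : R^o) 0.
  by apply: (is_derive_eq (is_derive_det (dS r))); rewrite tr0.
by rewrite -/(S t) (cst_of_deriv0 dp) /S scale0r addr0 det1.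
Qed.
End TraceZero.

Section NonSingular.
Hypothesis detR : forall y, \det (1%:M + Rm y) != 0.

(** The affine field [y |-> e + y *m Lm e] preserves [q y = \det (1 + Rm y)] up to
    the factor [\tr (Rm e)].  Starting from the point [y0] where its constant term
    becomes nilpotent for [Lm e], its integral curve is polynomial in time, and
    along it [q] is a nonzero polynomial proportional to its derivative. *)
Lemma trace_Rm_eq0 e : \tr (Rm e) = 0.
Proof.
have [k [D LkD]] := mx_pow_stable (Lm e).
(* [y0] moves the origin so that the constant term [e0] of the field is killed
   by [L ^+ k], as in Fitting's lemma. *)
pose L := Lm e; pose y0 := - (e *m D); pose e0 := e + y0 *m L.
have e0Lk : e0 *m L ^+ k = 0.
  rewrite /e0 mulmxDl -mulmxA -[L *m _]exprS -/L in LkD *.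
  by rewrite LkD /y0 mulNmx mulmxA subrr.
pose a (j : nat) : R := j`!%:R^-1.
have aS j : a j.+1 * j.+1%:R = a j.
  by rewrite /a factS natrM invfM mulrAC mulVf ?mul1r // pnatr_eq0.
(* the exponential series of the flow, which stops at [L ^+ k] *)
pose y (t : R) := y0 + \sum_(j < k) (a j.+1 * t ^+ j.+1) *: (e0 *m L ^+ j).
have dy t : is_derive t (1 : R) y (e + y t *m L).
  have -> : e + y t *m L = \sum_(j < k) (a j * t ^+ j) *: (e0 *m L ^+ j).
    rewrite /y mulmxDl addrA -/e0 mulmx_suml.
    have T m : \sum_(j < m) (a j * t ^+ j) *: (e0 *m L ^+ j) =
      e0 - (a m * t ^+ m) *: (e0 *m L ^+ m) +
      \sum_(j < m) (a j.+1 * t ^+ j.+1) *: (e0 *m L ^+ j) *m L.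
      elim: m => [|m IH].
        by rewrite !big_ord0 /a fact0 invr1 expr0 mulr1 scale1r mulmx1 subrr addr0.
      rewrite !big_ord_recr /= IH -scalemxAl -mulmxA -[L ^+ m *m L]exprSr.
      set A := (a m * _) *: _; set B := (a m.+1 * _) *: _; set C := \sum_(_ < _) _.
      by rewrite addrAC subrK [C + B]addrC addrA subrK.
    by rewrite T e0Lk scaler0 subr0.
  apply/is_derive_mxP => i l.
  rewrite (_ : (fun x => _) = cst (y0 i l) + \sum_(j < k)
     (a j.+1 * (e0 *m L ^+ j) i l) *: ((id : R -> R^o) ^+ j.+1)); last first.
    apply/funext => x; rewrite !fctE fct_sumE mxE summxE; congr (_ + _).
    by apply: eq_bigr => j _; rewrite mxE /GRing.scale /= fctE mulrAC.
  apply: (is_derive_eq (is_deriveD _ (is_derive_sum (fun j => is_deriveZ _ (is_deriveX _ (is_derive_id _ _)))))).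
  rewrite add0r summxE; apply: eq_bigr => j _; rewrite [RHS]mxE -(aS j).
  set c := (e0 *m _) i l; rewrite /GRing.scale /= mulr1.
  by rewrite -!mulrA; congr (_ * _); rewrite mulrC -mulrA.
(* the same curve, with polynomial coefficients: its determinant is [q] as a
   polynomial *)
pose SP : 'M[{poly R}]_n := map_mx polyC (1%:M + Rm y0) +
  \sum_(j < k) ((a j.+1)%:P * 'X^(j.+1)) *: map_mx polyC (Rm (e0 *m L ^+ j)).
have SPE t : map_mx (horner_eval t) SP = 1%:M + Rm (y t).
  rewrite RmD (big_morph Rm RmD Rm0) addrA.
  apply/matrixP => i j; rewrite mxE [LHS]/horner_eval !mxE !summxE hornerD hornerC.
  rewrite horner_sum; congr (_ + _); apply: eq_bigr => l _.
  by rewrite RmZ !mxE !hornerE.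
have QE t : (\det SP).[t] = \det (1%:M + Rm (y t)).
  by rewrite -SPE det_map_mx.
have Qn0 : \det SP != 0.
  by apply: contraNneq (detR (y 0)) => Q0; rewrite -QE Q0 horner0.
have dQ : (\det SP)^`() = \tr (Rm e) *: \det SP.
  apply/eqP; rewrite -subr_eq0; apply/eqP/poly_eq0_horner => t.
  rewrite hornerD hornerN hornerZ; apply/eqP; rewrite subr_eq0; apply/eqP.
  have [_ <-] := is_derive_poly (\det SP) t.
  have -> : horner (\det SP) = fun t => \det (1%:M + Rm (y t)).
    by apply/funext => s; rewrite QE.
  have dS : is_derive t (1 : R) (fun s => 1%:M + Rm (y s)) (Rm (e + y t *m L)).
    by have := is_deriveD (is_derive_cst 1%:M t 1) (is_derive_Rm (dy t)); rewrite add0r.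
  have [_ ->] := is_derive_det dS.
  set S := 1%:M + _; rewrite RmD mul_Lm.
  have -> : Rm e + Rm (pr e (y t)) = Rm e *m S + S *m L - L *m S.
    rewrite /S !mulmxDr !mulmxDl mul1mx !mulmx1.
    have /eqP := Rm_Lm_comm e (y t); rewrite eq_sym subr_eq => /eqP ->.
    exact: commutator_regroup.
  rewrite /= -/S; clearbody S.
  rewrite mulmxBl mulmxDl !linearD linearN /= -!(mulmxA _ S) mul_mx_adj.
  rewrite [X in _ + X - _]mxtrace_mulC mulmxA mul_adj_mx.
  by rewrite !mul_mx_scalar mul_scalar_mx addrK mxtraceZ mulrC.
apply: contraTeq isT => c0.
have := lt_size_deriv Qn0.
by rewrite dQ size_scale // ltnn.
Qed.
End NonSingular.

End LeftSymmetric.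

(** * Mean values, primitives and geometric limits *)

Section Norms.
Variable R : realType.

Lemma ler_entry_norm m n (M : 'M[R]_(m, n)) i j : `|M i j| <= `|M|.
Proof.
rewrite [leRHS]/Num.Def.normr /= mx_normrE.
exact: (le_bigmax _ (fun ij : 'I_m * 'I_n => `|M ij.1 ij.2|) (i, j)).
Qed.

Lemma ler_norm_mx m n (M : 'M[R]_(m, n)) c :
  0 <= c -> (forall i j, `|M i j| <= c) -> `|M| <= c.
Proof.
by move=> c0 H; rewrite [leLHS]/Num.Def.normr /= mx_normrE; apply: bigmax_le.
Qed.

Lemma ler_norm_mulmx m n p (A : 'M[R]_(m, n)) (B : 'M[R]_(n, p)) :
  `|A *m B| <= n%:R * `|A| * `|B|.
Proof.
apply: ler_norm_mx => [|i j]; first by rewrite !mulr_ge0.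
rewrite mxE; apply: le_trans (ler_norm_sum _ _ _) _.
have -> : n%:R * `|A| * `|B| = \sum_(k < n) `|A| * `|B|.
  by rewrite sumr_const card_ord -[RHS]mulr_natl mulrA.
by apply: ler_sum => k _; rewrite normrM ler_pM // ler_entry_norm.
Qed.

Lemma continuous_mxP (T : topologicalType) m n (f : T -> 'M[R]_(m, n)) (x : T) :
  (forall i j, {for x, continuous (fun y => f y i j : R^o)}) -> {for x, continuous f}.
Proof.
move=> cf; apply/cvgrPdist_lt => e e0.
have : \forall y \near x, forall ij : 'I_m * 'I_n, `|f x ij.1 ij.2 - f y ij.1 ij.2| < e / 2.
  apply: filter_forall => -[i j] /=.
  by move/cvgrPdist_lt : (cf i j); apply; rewrite divr_gt0.
apply: filterS => y H; apply: le_lt_trans (_ : e / 2 < e).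
  apply: ler_norm_mx => [|i j]; first by rewrite divr_ge0 // ltW.
  by rewrite !mxE; exact: ltW (H (i, j)).
by rewrite ltr_pdivrMr // ltr_pMr // ltr1n.
Qed.

Lemma mvt (f f' : R -> R^o) (a b : R) : a <= b ->
  (forall t, a <= t <= b -> is_derive t (1 : R) f (f' t)) ->
  exists2 t, a <= t <= b & f b - f a = f' t * (b - a).
Proof.
move=> ab df.
have df1 t : t \in `]a, b[ -> is_derive t (1 : R) f (f' t).
  by move=> /[!in_itv] /= /andP[? ?]; apply: df; rewrite !ltW.
have cf : {within `[a, b], continuous f}.
  apply/derivable_within_continuous => t; rewrite in_itv /= => tab.
  by case: (df t tab).
by have [t tab E] := MVT_segment ab df1 cf; exists t.
Qed.

Lemma mvt_le m n (F F' : R -> 'M[R]_(m, n)) (a b C : R) :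
  a <= b -> (forall t, a <= t <= b -> is_derive t (1 : R) F (F' t)) ->
  (forall t, a <= t <= b -> `|F' t| <= C) ->
  `|F b - F a| <= C * (b - a).
Proof.
move=> ab dF F'C.
have C0 : 0 <= C by apply: le_trans (F'C a _); rewrite ?lexx.
apply: ler_norm_mx => [|i j]; first by rewrite mulr_ge0 // subr_ge0.
have [t tab] := @mvt (fun s => F s i j) (fun s => F' s i j) a b ab
  (fun t tab => (is_derive_mxP _ _ _ _).1 (dF t tab) i j).
rewrite !mxE => ->; rewrite normrM [`|b - a|]ger0_norm ?subr_ge0 // ler_wpM2r ?subr_ge0 //.
exact: le_trans (ler_entry_norm _ _ _) (F'C _ tab).
Qed.

(** The bounded interval makes [f] integrable from the fixed base point [-2]. *)
Lemma continuous_primitive (f : R -> R) : continuous f ->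
  exists F : R -> R, F 0 = 0 /\ forall t, `|t| < 1 -> is_derive t (1 : R) F (f t).
Proof.
move=> cf; pose G x := (\int[lebesgue_measure]_(t in `[-2, x]) f t)%R.
exists (fun x => G x - G 0); rewrite subrr; split=> // t; rewrite ltr_norml => /andP[t1 t2].
have t3 : t < 2 by lra.
have t4 : -2 < t by lra.
have fi : lebesgue_measure.-integrable `[-2, 2] (EFin \o f).
  by apply: continuous_compact_integrable; [exact: segment_compact|exact: continuous_subspaceT].
have [dG Gt] := continuous_FTC1_closed t3 fi t4 (cf t).
have H : is_derive t (1 : R) G (f t) by split=> //; rewrite -derive1E.
by have := is_deriveB H (is_derive_cst (G 0) t 1); rewrite subr0.
Qed.

Lemma continuous_primitive_mx m n (f : R -> 'M[R]_(m, n)) : continuous f ->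
  exists F : R -> 'M[R]_(m, n),
    F 0 = 0 /\ forall t, `|t| < 1 -> is_derive t (1 : R) F (f t).
Proof.
move=> cf.
have cfij (ij : 'I_m * 'I_n) : continuous (fun t => f t ij.1 ij.2).
  by move=> t; exact: (continuous_comp (cf t) (@coord_continuous _ _ _ ij.1 ij.2 _)).
pose P ij := projT1 (cid (continuous_primitive (cfij ij))).
have PP ij := projT2 (cid (continuous_primitive (cfij ij))).
exists (fun t => \matrix_(i, j) P (i, j) t); split.
  by apply/matrixP => i j; rewrite !mxE; case: (PP (i, j)).
move=> t t1; apply/is_derive_mxP => i j; under eq_fun do rewrite mxE.
by case: (PP (i, j)) => _ /(_ _ t1).
Qed.

(** The intervals of radius [2 * C / 2 ^+ k] around [z k] are nested; this keeps an
    explicit rate, which the Picard iteration needs uniformly in time. *)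
Lemma geometric_limit (z : nat -> R) (C : R) :
  (forall k, `|z k.+1 - z k| <= C / 2 ^+ k) ->
  exists l, forall k, `|z k - l| <= 2 * C / 2 ^+ k.
Proof.
move=> H.
pose a k := z k - 2 * C / 2 ^+ k; pose b k := z k + 2 * C / 2 ^+ k.
have h k : 2 * C / 2 ^+ k.+1 = C / 2 ^+ k.
  by rewrite exprS invfM mulrACA divff ?mul1r // pnatr_eq0.
have h2 k : 2 * C / 2 ^+ k = C / 2 ^+ k + C / 2 ^+ k by rewrite -mulrA mulr2n mulrDl mul1r.
have C0 : 0 <= C by have := H 0; rewrite expr0 divr1; exact: le_trans.
have aS k : a k <= a k.+1.
  by rewrite /a h h2; have := H k; rewrite ler_norml => /andP[H1 H2]; lra.
have bS k : b k.+1 <= b k.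
  by rewrite /b h h2; have := H k; rewrite ler_norml => /andP[H1 H2]; lra.
have am i j : (i <= j)%N -> a i <= a j by move=> ij; apply: (homo_leq (@lexx _ _) (@le_trans _ _)) ij => k.
have bm i j : (i <= j)%N -> b j <= b i.
  by move=> ij; apply: (homo_leq (r := fun x y => y <= x) _ _ _ ij) => //= y x z' ? ?; apply: le_trans; eassumption.
have abk k : a k <= b k by rewrite lerD2l ge0_cp // divr_ge0 ?mulr_ge0 // exprn_ge0.
have ab i j : a i <= b j.
  apply: le_trans (am _ _ (leq_maxl i j)) _; apply: le_trans (abk _) _.
  exact: bm (leq_maxr i j).
have sA : has_sup (range a).
  by split; [exists (a 0); exists 0|exists (b 0) => _ [i _ <-]].
exists (sup (range a)) => k; rewrite ler_norml.
have l1 : a k <= sup (range a) by apply: (sup_upper_bound sA); exists k.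
have l2 : sup (range a) <= b k.
  by apply: (ge_sup sA.1) => _ [i _ <-].
by move: l1 l2; rewrite /a /b => *; apply/andP; split; lra.
Qed.

Lemma geometric_le0 (x C : R) : (forall k, x <= C / 2 ^+ k) -> x <= 0.
Proof.
move=> H; rewrite leNgt; apply/negP => x0.
have C0 : 0 < C by have := H 0; rewrite expr0 divr1; exact: lt_le_trans.
have [k] : exists k : nat, C / x < k%:R.
  by exists (Num.bound (C / x)); apply: archi_boundP; rewrite divr_ge0 // ltW.
rewrite ltr_pdivrMr // => Hk.
have := H k; rewrite ler_pdivlMr ?exprn_gt0 // leNgt; apply/negP.
rewrite negbK; apply: lt_trans Hk _; rewrite mulrC ltr_pM2l //.
by rewrite -natrX ltr_nat ltn_expl.
Qed.

End Norms.

(** * The Picard-Lindelof theorem *)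

Section Clamp.
Variables (R : realType) (d : R).
Hypothesis d0 : 0 <= d.

(** Truncating times and coordinates makes local hypotheses global, at no cost
    for Lipschitz constants. *)
Definition clamp (t : R) : R := Num.max (- d) (Num.min d t).

Lemma clamp_id t : `|t| <= d -> clamp t = t.
Proof.
by rewrite ler_norml => /andP[t1 t2]; rewrite /clamp min_r ?max_r.
Qed.

Lemma clamp_le t : `|clamp t| <= d.
Proof.
rewrite ler_norml /clamp le_max lexx ge_max ge_min lexx /= andbT.
by rewrite (le_trans _ d0) // oppr_le0.
Qed.

Lemma clamp_lip s t : `|clamp s - clamp t| <= `|s - t|.
Proof.
rewrite ler_norml /clamp; have := ler_norm (s - t); have := ler_norm (t - s).
rewrite distrC; have := d0; case: (leP d s); case: (leP d t) => ? ? ?.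
- by case: (leP (- d) d) => *; lra.
- by case: (leP (- d) d); case: (leP (- d) t) => *; lra.
- by case: (leP (- d) d); case: (leP (- d) s) => *; lra.
- by case: (leP (- d) t); case: (leP (- d) s) => *; lra.
Qed.

End Clamp.

Section Picard.
Variables (R : realType) (n : nat) (f : R -> 'rV[R]_n -> 'rV[R]_n).
Variables (L C : R) (z0 : 'rV[R]_n) (d : R).
Hypothesis fc : forall x, continuous (f^~ x).
Hypothesis L0 : 0 <= L.
Hypothesis fL : forall t x y, `|f t x - f t y| <= L * `|x - y|.
Hypothesis fC : forall t x, `|f t x| <= C.
Hypothesis d0 : 0 < d.
Hypothesis d1 : d < 1.
Hypothesis dL : d * L <= 1 / 2.

Let C0 : 0 <= C. Proof. by apply: le_trans (fC 0 z0). Qed.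

Let clamp := clamp d.

Let continuous_comp_f (y : R -> 'rV[R]_n) : continuous y -> continuous (fun s => f s (y s)).
Proof.
move=> cy s; apply/cvgrPdist_lt => e e0.
have e2 : 0 < e / 2 by rewrite divr_gt0.
have e3 : 0 < e / (2 * (L + 1)) by rewrite divr_gt0 // mulr_gt0 // ltr_wpDl.
have /cvgrPdist_lt/(_ _ e2) H1 := @fc (y s) s.
have /cvgrPdist_lt/(_ _ e3) H2 := cy s.
near=> t.
have h1 : `|f s (y s) - f t (y s)| < e / 2 by near: t.
have h2 : `|y s - y t| < e / (2 * (L + 1)) by near: t.
rewrite -(subrKA (f t (y s))) (le_lt_trans (ler_normD _ _)) // (splitr e) ltrD //.
apply: le_lt_trans (fL _ _ _) _; apply: le_lt_trans (ler_wpM2l L0 (ltW h2)) _.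
have L1 : 0 < L + 1 by rewrite ltr_wpDl.
rewrite (_ : L * _ = e / 2 * (L / (L + 1))); last by field; rewrite gt_eqF.
by rewrite gtr_pMr // ltr_pdivrMr // mul1r ltrDl.
Unshelve. all: by end_near. Qed.

(** A total choice of primitives, so that Picard's operator can be iterated on
    arbitrary functions. *)
Let prim (g : R -> 'rV[R]_n) : R -> 'rV[R]_n :=
  if pselect (continuous g) is left cg then projT1 (cid (continuous_primitive_mx cg))
  else cst 0.

Let prim0 g : prim g 0 = 0.
Proof. by rewrite /prim; case: pselect => // cg; case: cid => F []. Qed.

Let is_derive_prim g t : continuous g -> `|t| < 1 -> is_derive t (1 : R) (prim g) (g t).
Proof. by rewrite /prim; case: pselect => // cg _; case: cid => F [_ H] /=; exact: H. Qed.

Let clamp_le1 t : `|clamp t| < 1.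
Proof. exact: le_lt_trans (clamp_le (ltW d0) t) d1. Qed.

Let prim_lip g M s t : continuous g -> (forall t, `|g t| <= M) ->
  `|prim g (clamp t) - prim g (clamp s)| <= M * `|clamp t - clamp s|.
Proof.
move=> cg gM; have M0 : 0 <= M by apply: le_trans (gM 0).
have H a b : `|a| < 1 -> `|b| < 1 -> a <= b -> `|prim g b - prim g a| <= M * `|b - a|.
  rewrite !ltr_norml => /andP[a1 a2] /andP[b1 b2] ab.
  rewrite [`|b - a|]ger0_norm ?subr_ge0 //; apply: mvt_le => // r /andP[r1 r2].
  by apply: is_derive_prim => //; rewrite ltr_norml; apply/andP; split; lra.
case: (leP (clamp s) (clamp t)) => [|/ltW] st; first exact: H.
by rewrite distrC [X in _ * X]distrC; exact: H.
Qed.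

Let primB g h M t : continuous g -> continuous h -> (forall t, `|g t - h t| <= M) ->
  `|prim g (clamp t) - prim h (clamp t)| <= d * M.
Proof.
move=> cg ch ghM; have M0 : 0 <= M by apply: le_trans (ghM 0).
have H (s : R) : `|s| < 1 -> is_derive s (1 : R) (fun r => prim g r - prim h r) (g s - h s).
  by move=> s1; apply: is_deriveB; apply: is_derive_prim.
have := clamp_le1 t; have : `|clamp t| <= d := clamp_le (ltW d0) t; move: (clamp t) => {}t td t1.
apply: le_trans (_ : M * `|t| <= _); last by rewrite mulrC ler_wpM2r.
move: (t1); rewrite ltr_norml => /andP[t2 t3].
case: (leP 0 t) => [t0|/ltW t0].
  have := @mvt_le R 1 n (fun r => prim g r - prim h r) (fun r => g r - h r) 0 t M t0.
  rewrite /= !prim0 !subr0 [`|t|]ger0_norm //; apply => // r /andP[r1 r2].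
  by apply: H; rewrite ltr_norml; apply/andP; split; lra.
have := @mvt_le R 1 n (fun r => prim g r - prim h r) (fun r => g r - h r) t 0 M t0.
rewrite /= !prim0 subr0 !sub0r normrN [`|t|]ler0_norm //; apply => // r /andP[r1 r2].
by apply: H; rewrite ltr_norml; apply/andP; split; lra.
Qed.

(** Picard's operator, with time clamped to [[-d, d]]: all estimates then hold
    on the whole line. *)
Let step (y : R -> 'rV[R]_n) t := z0 + prim (fun s => f s (y s)) (clamp t).

Let lip_continuous (y : R -> 'rV[R]_n) : (forall s t, `|y t - y s| <= C * `|t - s|) -> continuous y.
Proof.
move=> H s; apply/cvgrPdist_lt => e e0.
have e1 : 0 < e / (C + 1) by rewrite divr_gt0 // ltr_wpDl.
exists (e / (C + 1)) => //= t /= st; apply: le_lt_trans (H _ _) _.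
apply: le_lt_trans (_ : (C + 1) * `|s - t| < e); first by rewrite ler_wpM2r // lerDl.
by rewrite mulrC -ltr_pdivlMr // ltr_wpDl.
Qed.

Let step_lip y : continuous y -> forall s t, `|step y t - step y s| <= C * `|t - s|.
Proof.
move=> cy s t; rewrite /step opprD addrACA subrr add0r.
apply: le_trans (ler_wpM2l C0 (clamp_lip (ltW d0) t s)).
by apply: prim_lip => [|r]; [exact: continuous_comp_f|exact: fC].
Qed.

Let step_near y : continuous y -> forall t, `|step y t - z0| <= C * d.
Proof.
move=> cy t; rewrite /step addrAC subrr add0r.
have := @prim_lip (fun s => f s (y s)) C 0 t (continuous_comp_f cy) (fun t => fC _ _).
have -> : clamp 0 = 0 by apply: clamp_id; rewrite normr0 ltW.
by rewrite prim0 !subr0 => /le_trans; apply; rewrite ler_wpM2l // clamp_le // ltW.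
Qed.

Let step_contract y1 y2 M : continuous y1 -> continuous y2 ->
  (forall t, `|y1 t - y2 t| <= M) -> forall t, `|step y1 t - step y2 t| <= M / 2.
Proof.
move=> c1 c2 H t; rewrite /step opprD addrACA subrr add0r.
have M0 : 0 <= M by apply: le_trans (H 0).
apply: le_trans (_ : d * (L * M) <= _).
  apply: primB => [||s]; [exact: continuous_comp_f|exact: continuous_comp_f|].
  by apply: le_trans (fL _ _ _) _; rewrite ler_wpM2l.
rewrite mulrA [leRHS]mulrC ler_wpM2r //.
by apply: le_trans dL _; rewrite mul1r.
Qed.

(** The increments of the Picard iterates are halved at each step because
    [d * L <= 1 / 2]. The limit is Lipschitz since all the iterates are, and it is
    a fixed point by the same contraction estimate. *)
Lemma picard_lindelof : exists y : R -> 'rV[R]_n, [/\ y 0 = z0,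
  (forall t, `|y t - z0| <= C * d) &
  (forall t, `|t| < d -> is_derive t (1 : R) y (f t (y t)))].
Proof.
pose z k := iter k step (cst z0).
have zL k s t : `|z k t - z k s| <= C * `|t - s|.
  elim: k s t => [|k IH] s t; first by rewrite /= subrr normr0 mulr_ge0.
  exact: step_lip (lip_continuous IH) _ _.
have zc k : continuous (z k) by apply: lip_continuous => s t; exact: zL.
have z1 t : `|z 1%N t - z 0%N t| <= C.
  apply: le_trans (step_near (@cst_continuous _ _ z0) t) _.
  by rewrite ler_piMr // ltW.
have zS k t : `|z k.+1 t - z k t| <= C / 2 ^+ k.
  elim: k t => [|k IH] t; first by rewrite expr0 divr1; exact: z1.
  have -> : C / 2 ^+ k.+1 = C / 2 ^+ k / 2 by rewrite exprSr invfM mulrA.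
  exact: (step_contract (zc k.+1) (zc k) IH t).
have lim t (i : 'I_n) : exists l, forall k, `|z k t 0 i - l| <= 2 * C / 2 ^+ k.
  apply: geometric_limit => k.
  have := ler_entry_norm (z k.+1 t - z k t) 0 i; rewrite !mxE => /le_trans; apply.
  exact: zS.
pose y t : 'rV[R]_n := \row_i projT1 (cid (lim t i)).
have yP t k : `|z k t - y t| <= 2 * C / 2 ^+ k.
  apply: ler_norm_mx => [|i j]; first by rewrite divr_ge0 ?mulr_ge0 // exprn_ge0.
  by rewrite ord1 !mxE; exact: (projT2 (cid (lim t j))).
have yL s t : `|y t - y s| <= C * `|t - s|.
  rewrite -subr_le0; apply: (@geometric_le0 R _ (4 * C)) => k.
  rewrite lerBlDr.
  rewrite -(subrKA (z k t)) -[z k t - y s](subrKA (z k s)).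
  apply: le_trans (ler_normD _ _) _; rewrite distrC.
  apply: le_trans (lerD (yP _ _) (ler_normD _ _)) _.
  by have := zL k s t; have := yP s k; lra.
have yc : continuous y by exact: lip_continuous.
have yE t : y t = step y t.
  apply/eqP; rewrite -subr_eq0 -normr_le0; apply: (@geometric_le0 R _ (4 * C)) => k.
  rewrite -(subrKA (z k.+1 t)); apply: le_trans (ler_normD _ _) _.
  have h1 := yP t k.+1; rewrite distrC in h1.
  have h2 : `|z k.+1 t - step y t| <= 2 * C / 2 ^+ k / 2.
    exact: (step_contract (zc k) yc (fun s => yP s k) t).
  apply: le_trans (lerD h1 h2) _.
  have -> : 2 * C / 2 ^+ k.+1 = C / 2 ^+ k.
    by rewrite exprS invfM mulrACA divff ?mul1r // pnatr_eq0.
  have -> : 2 * C / 2 ^+ k / 2 = C / 2 ^+ k.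
    by rewrite mulrC !mulrA mulVf ?mul1r // pnatr_eq0.
  rewrite -[4 * C / _]mulrA; have : 0 <= C / 2 ^+ k by rewrite divr_ge0 // exprn_ge0.
  by move=> a0; rewrite -[leLHS]mulr2n -[leLHS]mulr_natl ler_wpM2r // ler_nat.
have y0 : y 0 = z0.
  by rewrite yE /step [clamp 0]clamp_id ?normr0 ?ltW // prim0 addr0.
exists y; split=> // t.
- by rewrite yE; exact: step_near.
- move=> td.
  have H : is_derive t (1 : R) (fun s => z0 + prim (fun s => f s (y s)) s) (f t (y t)).
    have Hp := is_derive_prim (continuous_comp_f yc) (lt_trans td d1).
    by have := is_deriveD (is_derive_cst z0 t 1) Hp; rewrite add0r.
  apply: near_eq_is_derive H.
  have [e e0 He] : exists2 e, 0 < e & forall s, `|t - s| < e -> `|s| < d.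
    exists (d - `|t|); first by rewrite subr_gt0.
    by move=> s ts; rewrite -[s](subKr t) (le_lt_trans (ler_normB _ _)) // -ltrBrDl.
  by exists e => //= s /= /He sd; rewrite [RHS]yE /step [clamp s]clamp_id // ltW.
Qed.
End Picard.

(** * Chain rule along curves, local flows and second derivatives *)

Section CurveChain.
Variables (R : realType) (E F : normedModType R).

Lemma is_derive_curve (f : E -> F) (c : R -> E) (t : R) c' :
  is_derive t (1 : R) c c' -> differentiable f (c t) ->
  is_derive t (1 : R) (f \o c) ('D_c' f (c t)).
Proof.
move=> [dc <-] df.
have dc' : differentiable c t by apply/derivable1_diffP.
have dfc : differentiable (f \o c) t by exact: differentiable_comp.
split; first by apply/derivable1_diffP.
by rewrite deriveE // diff_comp // [RHS]deriveE //= deriveE.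
Qed.

Lemma derive_scale (f : E -> F) (x v : E) (k : R) :
  differentiable f x -> 'D_(k *: v) f x = k *: 'D_v f x.
Proof. by move=> df; rewrite !deriveE // linearZ. Qed.

Lemma is_derive_line (p v : E) (t : R) : is_derive t (1 : R) (fun s => p + s *: v) v.
Proof.
have ds : is_derive t (1 : R) ( *:%R^~ v) v.
  split; first exact/derivable1_diffP.
  by rewrite deriveE // diff_val scale1r.
by have := is_deriveD (is_derive_cst p t 1) ds; rewrite add0r.
Qed.

End CurveChain.

Lemma continuous_mulmx (R : realType) (T : topologicalType) m n p
    (f : T -> 'M[R]_(m, n)) (g : T -> 'M[R]_(n, p)) (x : T) :
  {for x, continuous f} -> {for x, continuous g} ->
  {for x, continuous (fun y => f y *m g y)}.
Proof.
move=> cf cg; apply: continuous_mxP => i j.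
rewrite (_ : (fun y => _) = fun y => \sum_k (f y i k * g y k j : R^o)); last first.
  by apply/funext => y; rewrite mxE.
have ck k : {for x, continuous (fun y => f y i k * g y k j : R^o)}.
  apply: continuousM.
    exact: (continuous_comp cf (@coord_continuous _ _ _ i k _)).
  exact: (continuous_comp cg (@coord_continuous _ _ _ k j _)).
elim: (index_enum _) => [|k s IH].
  rewrite (_ : (fun y => _) = cst 0); first exact: cst_continuous.
  by apply/funext => y; rewrite big_nil.
rewrite (_ : (fun y => _) = fun y => (f y i k * g y k j : R^o) + \sum_(l <- s) f y i l * g y l j).
  exact: (continuousD (ck k) IH).
by apply/funext => y; rewrite big_cons.
Qed.

Section C1Lipschitz.
Variable R : realType.

Lemma derive_rV (E : normedModType R) n (f : 'rV[R]_n -> E) x v :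
  differentiable f x -> 'D_v f x = \sum_k v 0 k *: 'D_(delta_mx 0 k) f x.
Proof.
move=> df; rewrite deriveE // {1}[v]row_sum_delta linear_sum.
by apply: eq_bigr => k _; rewrite linearZ /= deriveE.
Qed.

(** Mean value inequality along segments, with the partial derivatives bounded by
    one more than their norms at [z0]. *)
Lemma C1_lipschitz n p q (M : 'rV[R]_n -> 'M[R]_(p, q)) (z0 : 'rV[R]_n) :
  (\forall x \near z0, differentiable M x) ->
  (forall k, {for z0, continuous ('D_(delta_mx 0 k) M)}) ->
  exists r L, [/\ 0 < r, 0 <= L & forall x y, `|x - z0| <= r -> `|y - z0| <= r ->
    `|M x - M y| <= L * `|x - y|].
Proof.
move=> dM cM.
pose L := \sum_k (`|'D_(delta_mx 0 k) M z0| + 1).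
have bM : \forall x \near z0,
    forall k : 'I_n, `|'D_(delta_mx 0 k) M x| <= `|'D_(delta_mx 0 k) M z0| + 1.
  apply: (@filter_forall _ _ (fun (k : 'I_n) x => `|'D_(delta_mx 0 k) M x| <= `|'D_(delta_mx 0 k) M z0| + 1) (nbhs z0) _) => k.
  have /cvgrPdist_le/(_ _ ltr01) := cM k; apply: filterS => x H.
  rewrite -[X in `|X|](subrK ('D_(delta_mx 0 k) M z0)) addrC.
  by apply: le_trans (ler_normD _ _) _; rewrite lerD2l distrC.
have [r /= r0 H] := (nbhs_ballP z0 _).1 (filterI dM bM); exists (r / 2), L; split; first by rewrite divr_gt0.
  by apply: sumr_ge0 => k _; rewrite addr_ge0.
move=> x y xr yr.
have seg s : 0 <= s <= 1 -> ball z0 r (y + s *: (x - y)).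
  move=> /andP[s0 s1]; rewrite -ball_normE /ball_ /= distrC.
  rewrite (_ : _ - z0 = s *: (x - z0) + (1 - s) *: (y - z0)); last first.
    by apply/rowP => k; rewrite !mxE; ring.
  apply: le_lt_trans (ler_normD _ _) _; rewrite !normrZ !ger0_norm ?subr_ge0 //.
  apply: le_lt_trans (_ : r / 2 < r); last by rewrite ltr_pdivrMr // ltr_pMr // ltr1n.
  have := ler_wpM2l s0 xr; have : (1 - s) * `|y - z0| <= (1 - s) * (r / 2).
    by rewrite ler_wpM2l // subr_ge0.
  by rewrite mulrBl mul1r; lra.
have := @mvt_le R p q (fun s => M (y + s *: (x - y)))
  (fun s => 'D_(x - y) M (y + s *: (x - y))) 0 1 (L * `|x - y|) ler01.
rewrite scale1r scale0r addr0 (addrC y) subrK subr0 mulr1; apply.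
  move=> t t01; apply: (is_derive_curve (is_derive_line _ _ _)).
  by case: (H _ (seg _ t01)).
move=> t /seg/H[dt bt]; rewrite derive_rV //.
apply: le_trans (ler_norm_sum _ _ _) _; rewrite /L mulr_suml; apply: ler_sum => k _.
by rewrite normrZ mulrC ler_pM // ler_entry_norm.
Qed.

End C1Lipschitz.

Section LocalFlow.
Variables (R : realType) (n : nat) (M : 'rV[R]_n -> 'M[R]_n) (z0 : 'rV[R]_n).
Variables (r L C : R).
Hypothesis r0 : 0 < r.
Hypothesis L0 : 0 <= L.
Hypothesis ML : forall x y, `|x - z0| <= r -> `|y - z0| <= r ->
    `|M x - M y| <= L * `|x - y|.
Hypothesis MC : forall x, `|x - z0| <= r -> `|M x| <= C.

(** The retraction onto the box of radius [r] for the sup norm turns the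
    hypotheses on [M] near [z0] into global ones. *)
Let box (x : 'rV[R]_n) : 'rV[R]_n := z0 + \row_i clamp r ((x - z0) 0 i).

Let box_le x : `|box x - z0| <= r.
Proof.
rewrite /box addrAC subrr add0r; apply: ler_norm_mx => [|i j]; first exact: ltW.
by rewrite mxE clamp_le // ltW.
Qed.

Let box_lip x y : `|box x - box y| <= `|x - y|.
Proof.
apply: ler_norm_mx => // i j; rewrite !mxE opprD addrACA subrr add0r.
apply: le_trans (clamp_lip (ltW r0) _ _) _.
rewrite opprB addrA subrK.
by have := ler_entry_norm (x - y) 0 j; rewrite !mxE.
Qed.

Let box_id x : `|x - z0| <= r -> box x = x.
Proof.
move=> xr; apply/rowP => i; rewrite !mxE clamp_id; last first.
  by have := ler_entry_norm (x - z0) 0 i; rewrite !mxE => /le_trans; apply.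
by rewrite addrC subrK.
Qed.

(** The point of the order of the quantifiers is that [d] depends on [w] only
    through its bound [B]. *)
Lemma local_flow (B : R) : 0 <= B -> exists2 d, 0 < d &
  forall w : R -> 'rV[R]_n, continuous w -> (forall t, `|w t| <= B) ->
  exists y : R -> 'rV[R]_n, [/\ y 0 = z0, (forall t, `|y t - z0| <= r) &
    forall t, `|t| < d -> is_derive t (1 : R) y (w t *m M (y t))].
Proof.
move=> B0.
have C0 : 0 <= C by apply: le_trans (MC (x := z0) _); rewrite ?subrr ?normr0 // ltW.
pose L' := n%:R * B * L; pose C' := n%:R * B * C.
have L'0 : 0 <= L' by rewrite !mulr_ge0.
have C'0 : 0 <= C' by rewrite !mulr_ge0.
pose d := Num.min (1 / 2) (Num.min ((1 / 2) / (L' + 1)) (r / (C' + 1))).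
have d0 : 0 < d.
  by rewrite !lt_min !divr_gt0 // ltr_wpDl.
exists d => // w cw wB.
have d1 : d < 1 by rewrite /d gt_min; apply/orP; left; lra.
have dL : d * L' <= 1 / 2.
  apply: le_trans (_ : d * (L' + 1) <= _); first by rewrite ler_wpM2l ?lerDl // ltW.
  by rewrite -ler_pdivlMr ?ltr_wpDl // /d !ge_min lexx orbT.
have dC : C' * d <= r.
  apply: le_trans (_ : (C' + 1) * d <= _); first by rewrite ler_wpM2r ?lerDl // ltW.
  by rewrite mulrC -ler_pdivlMr ?ltr_wpDl // /d !ge_min lexx !orbT.
have bound A (t : R) (c : R) : 0 <= c -> `|A| <= c -> `|w t *m A| <= n%:R * B * c.
  move=> c0 Ac; apply: le_trans (ler_norm_mulmx _ _) _.
  by apply: ler_pM; rewrite ?mulr_ge0 // ler_wpM2l.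
have fc x : continuous (fun t => w t *m M (box x)).
  by move=> t; apply: continuous_mulmx; [exact: cw|exact: cst_continuous].
have fL t x y : `|w t *m M (box x) - w t *m M (box y)| <= L' * `|x - y|.
  rewrite -mulmxBr /L' -mulrA; apply: bound; first by rewrite mulr_ge0.
  by apply: le_trans (ML (box_le _) (box_le _)) _; rewrite ler_wpM2l // box_lip.
have fC t x : `|w t *m M (box x)| <= C' by apply: bound => //; exact: MC.
have [y [y0 yr dy]] := picard_lindelof z0 fc L'0 fL fC d0 d1 dL.
have yr' t : `|y t - z0| <= r by exact: le_trans (yr t) dC.
by exists y; split=> // t /dy; rewrite box_id.
Qed.
End LocalFlow.

Section Schwarz.
Variables (R : realType) (E : normedModType R).

Let secdiff (f : E -> R) p u v (h : R) :=
  f (p + h *: u + h *: v) - f (p + h *: u) - (f (p + h *: v) - f p).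

Let secdiffC f p u v h : secdiff f p u v h = secdiff f p v u h.
Proof.
rewrite /secdiff [p + h *: u + h *: v]addrAC; move: (f _) (f _) (f _) (f _) => a b c e.
rewrite !opprB addrACA [RHS]addrACA.
by congr (_ + _); exact: addrC.
Qed.

(** The mean value theorem is applied to the difference in direction [v] as a
    function of the step along [u], and then along [v]. *)
Lemma second_difference (f : E -> R^o) (p u v : E) (r h : R) :
  (forall q, `|q - p| < r -> differentiable f q /\ differentiable ('D_u f) q) ->
  0 < h -> h * (`|u| + `|v|) < r ->
  exists2 q, `|q - p| <= h * (`|u| + `|v|) &
    secdiff f p u v h = h ^+ 2 * 'D_v ('D_u f) q.
Proof.
move=> H h0 hr.
have near_p (a b : R) : 0 <= a <= h -> 0 <= b <= h ->
    `|p + a *: u + b *: v - p| <= h * (`|u| + `|v|).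
  move=> /andP[a0 ah] /andP[b0 bh]; rewrite -(addrA p) addrAC subrr add0r mulrDr.
  apply: le_trans (ler_normD _ _) _; rewrite !normrZ !ger0_norm //.
  by rewrite lerD // ler_wpM2r.
have near_p' (a b : R) : 0 <= a <= h -> 0 <= b <= h -> `|p + a *: u + b *: v - p| < r.
  by move=> ha hb; exact: le_lt_trans (near_p a b ha hb) hr.
have h01 : 0 <= h <= h by rewrite lexx ltW.
have h00 : 0 <= (0 : R) <= h by rewrite lexx ltW.
pose phi s := f (p + s *: u + h *: v) - f (p + s *: u) : R^o.
have dphi (s : R) : 0 <= s <= h ->
   is_derive s (1 : R) phi ('D_u f (p + s *: u + h *: v) - 'D_u f (p + s *: u)).
  move=> hs; apply: is_deriveB.
    have dl : is_derive s (1 : R) (fun s => p + s *: u + h *: v) u.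
      have := is_derive_line (p + h *: v) u s.
      by congr is_derive; apply/funext => x; rewrite addrAC.
    by apply: (is_derive_curve dl); case: (H _ (near_p' _ _ hs h01)).
  apply: (is_derive_curve (is_derive_line p u s)).
  by case: (H _ (near_p' _ _ hs h00)); rewrite scale0r addr0.
have [s hs E1] := mvt (ltW h0) dphi.
pose psi t := 'D_u f (p + s *: u + t *: v).
have dpsi (t : R) : 0 <= t <= h -> is_derive t (1 : R) psi ('D_v ('D_u f) (p + s *: u + t *: v)).
  move=> ht; apply: (is_derive_curve (is_derive_line (p + s *: u) v t)).
  by case: (H _ (near_p' _ _ hs ht)).
have [t ht E2] := mvt (ltW h0) dpsi.
exists (p + s *: u + t *: v); first exact: near_p.
move: E1 E2; rewrite /phi /psi /secdiff !scale0r !addr0 !subr0 => -> ->.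
by rewrite mulrC mulrA mulrAC.
Qed.

(** The second difference is symmetric in [u] and [v]; dividing it by [h ^+ 2]
    gives both mixed derivatives at points close to [p]. *)
Lemma derive_comm (f : E -> R^o) (p u v : E) :
  (\forall q \near p, [/\ differentiable f q, differentiable ('D_u f) q &
     differentiable ('D_v f) q]) ->
  {for p, continuous ('D_v ('D_u f))} -> {for p, continuous ('D_u ('D_v f))} ->
  'D_v ('D_u f) p = 'D_u ('D_v f) p.
Proof.
move=> H c1 c2; apply/eqP; rewrite -subr_eq0 -normr_le0; apply/ler_addgt0Pr => e e0.
have e2 : 0 < e / 2 by rewrite divr_gt0.
have /cvgrPdist_le/(_ _ e2) n1 := c1; have /cvgrPdist_le/(_ _ e2) n2 := c2.
have [r /= r0] := (nbhs_ballP p _).1 (filterI H (filterI n1 n2)).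
rewrite -ball_normE /ball_ => Hr.
pose h := r / (`|u| + `|v| + 1).
have h0 : 0 < h by rewrite divr_gt0 // ltr_wpDl // addr_ge0.
have hr : h * (`|u| + `|v|) < r.
  by rewrite /h mulrAC ltr_pdivrMr ?ltr_pM2l ?ltrDl // ltr_wpDl // addr_ge0.
have Hs q : `|q - p| < r -> `|p - q| < r by rewrite distrC.
have {Hs}Hr q hq := Hr q (Hs q hq).
have [q1 hq1 E1] : exists2 q, `|q - p| <= h * (`|u| + `|v|) &
    secdiff f p u v h = h ^+ 2 * 'D_v ('D_u f) q.
  by apply: second_difference hr => // q /Hr [[]].
have [q2 hq2 E2] : exists2 q, `|q - p| <= h * (`|v| + `|u|) &
    secdiff f p v u h = h ^+ 2 * 'D_u ('D_v f) q.
  by apply: (@second_difference _ _ _ _ r) => //; [move=> q /Hr [[]]|rewrite addrC].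
rewrite (addrC `|v|) in hq2.
have E12 : 'D_v ('D_u f) q1 = 'D_u ('D_v f) q2.
  apply: (@mulfI _ (h ^+ 2)); first by rewrite expf_neq0 // gt_eqF.
  exact: (etrans (esym E1) (etrans (secdiffC f p u v h) E2)).
have [_ [b1 _]] := Hr _ (le_lt_trans hq1 hr).
have [_ [_ b2]] := Hr _ (le_lt_trans hq2 hr).
rewrite add0r -(subrKA ('D_v ('D_u f) q1) ('D_v ('D_u f) p)); apply: le_trans (ler_normD _ _) _.
rewrite (splitr e); apply: lerD; first exact: b1.
by rewrite E12 distrC; exact: b2.
Qed.
End Schwarz.

(** * Differentiability and smoothness are local *)

Lemma near_eq_continuous (T U : topologicalType) (f g : T -> U) (x : T) :
  (\forall y \near x, f y = g y) -> {for x, continuous f} -> {for x, continuous g}.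
Proof.
move=> fg cf; rewrite /prop_for /continuous_at -(nbhs_singleton fg).
by apply: cvg_trans cf; exact: near_eq_cvg.
Qed.

Section NearDiff.
Variables (R : realType) (V W : normedModType R).

Lemma near_eq_differentiable (f g : V -> W) (x : V) :
  (\forall y \near x, f y = g y) -> differentiable f x -> differentiable g x.
Proof.
move=> fg df; have [dfc /eqaddoP E] := (diff_locallyP x f).1 df.
have H : g \o shift x = cst (g x) + 'd f x +o_ 0 id.
  apply/eqaddoP => e e0; have Ee := E e e0.
  have fg0 : \forall h \near (0 : V), f (h + x) = g (h + x).
    by have := fg; rewrite (near_shift 0 x) subr0.
  near=> h; rewrite !fctE /= -(near fg0 h) // -(nbhs_singleton fg).
  by near: h; exact: Ee.
by apply/diff_locallyP; rewrite (diff_unique dfc H).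
Unshelve. all: by end_near. Qed.

(** [Cn] mentions derivatives on the whole space, hence equality on [U] must be
    propagated to them; openness of [U] is what allows it. *)
Lemma Cn_ext k (U : set V) (f g : V -> W) : open U ->
  (forall x, U x -> f x = g x) -> Cn k U f -> Cn k U g.
Proof.
move=> oU; elim: k f g => [|k IH] f g fg /=.
  move=> cf x Ux; have nfg : \forall y \near x, f y = g y.
    by have := open_nbhs_nbhs (conj oU Ux); apply: filterS => y /fg.
  rewrite /prop_for /continuous_at -(fg x Ux); apply: cvg_trans (cf x Ux).
  exact: near_eq_cvg.
have nfg x : U x -> \forall y \near x, f y = g y.
  by move=> Ux; have := open_nbhs_nbhs (conj oU Ux); apply: filterS => y /fg.
move=> [df Df]; split=> [x Ux|v].
  exact: near_eq_differentiable (nfg x Ux) (df x Ux).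
by apply: IH (Df v) => x Ux; apply: near_eq_derive; exact: nfg.
Qed.

Lemma smooth_differentiable (U : set V) (f : V -> W) x :
  smooth U f -> U x -> differentiable f x.
Proof. by move=> /(_ 1%N)[df _]; exact: df. Qed.

Lemma smooth_derive (U : set V) (f : V -> W) v : smooth U f -> smooth U ('D_v f).
Proof. by move=> sf k; have [_] := sf k.+1; exact. Qed.

Lemma smooth_continuous (U : set V) (f : V -> W) x :
  smooth U f -> U x -> {for x, continuous f}.
Proof. by move=> /(_ 0%N); exact. Qed.

Lemma smooth_cst (U : set V) (w : W) : smooth U (cst w).
Proof.
move=> k; elim: k w => [|k IH] w /=; first by move=> x _; exact: cst_continuous.
split=> [x _|v]; first exact: differentiable_cst.
by rewrite (_ : 'D_v _ = cst 0) //; apply/funext => x; exact: derive_cst.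
Qed.

End NearDiff.

Section SmoothCoord.
Variables (R : realType) (V : normedModType R).

Lemma smooth_entry m n (U : set V) (f : V -> 'M[R]_(m, n)) i j : open U ->
  smooth U f -> smooth U (fun z => f z i j : R^o).
Proof.
move=> oU sf k; elim: k f sf => [|k IH] f sf /=.
  move=> x Ux.
  have cf : {for x, continuous f} by exact: smooth_continuous sf Ux.
  exact: (continuous_comp cf (@coord_continuous _ _ _ i j _)).
have df x : U x -> differentiable (fun z => f z i j : R^o) x.
  move=> Ux; have dfx := smooth_differentiable sf Ux.
  exact: (differentiable_comp dfx (differentiable_coord (f x) i j)).
split=> // v; apply: Cn_ext (IH _ (smooth_derive v sf)) => // x Ux.
rewrite derive_mx ?mxE //.
exact/diff_derivable/(smooth_differentiable sf).
Qed.

Lemma differentiable_mx m n (f : V -> 'M[R]_(m, n)) x :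
  (forall i j, differentiable (fun z => f z i j : R^o) x) -> differentiable f x.
Proof.
move=> df.
rewrite (_ : f = \sum_i \sum_j (fun z => (f z i j : R^o) *: (delta_mx i j : 'M[R]_(m, n)))).
  apply: differentiable_sum => i; apply: differentiable_sum => j.
  exact: (differentiableZl (delta_mx i j : 'M[R]_(m, n)) (df i j)).
apply/funext => z; rewrite fct_sumE [LHS]matrix_sum_delta.
by apply: eq_bigr => i _; rewrite fct_sumE.
Qed.

End SmoothCoord.

Section PairDerivatives.
Variables (R : realType) (V W1 W2 : normedModType R).

Lemma is_derive_pair (f : V -> W1) (g : V -> W2) x v f' g' :
  is_derive x v f f' -> is_derive x v g g' ->
  is_derive x v (fun y => (f y, g y)) (f', g').
Proof.
move=> [df vf] [dg vg].
have c : h^-1 *: (((fun y => (f y, g y)) \o shift x) (h *: v) - (f x, g x))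
    @[h --> 0^'] --> (f', g').
  by rewrite -vf -vg; exact: (cvg_pair df dg).
by split; [apply/cvg_ex; exists (f', g')|exact: cvg_lim].
Qed.

Lemma is_derive_fst (f : V -> W1 * W2) x v f' :
  is_derive x v f f' -> is_derive x v (fun y => (f y).1) f'.1.
Proof.
move=> [df vf].
have c : h^-1 *: (((fun y => (f y).1) \o shift x) (h *: v) - (f x).1)
    @[h --> 0^'] --> f'.1.
  have cf : {for f', continuous (fun z : W1 * W2 => z.1)}.
    by case: f' {vf} => a b; exact: cvg_fst.
  have df' : h^-1 *: ((f \o shift x) (h *: v) - f x) @[h --> 0^'] --> f'.
    by rewrite -vf; exact: df.
  exact: (cvg_comp _ _ df' cf).
by split; [apply/cvg_ex; exists f'.1|exact: cvg_lim].
Qed.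

Lemma is_derive_on_fst (U1 U2 : normedModType R) (f : U1 -> V) x1 x2 v1 v2 f' :
  is_derive x1 v1 f f' -> is_derive (x1, x2) (v1, v2) (fun z : U1 * U2 => f z.1) f'.
Proof. by case=> df vf; split; [exact: df|exact: vf]. Qed.

Lemma is_derive_on_snd (U1 U2 : normedModType R) (f : U2 -> V) x1 x2 v1 v2 f' :
  is_derive x2 v2 f f' -> is_derive (x1, x2) (v1, v2) (fun z : U1 * U2 => f z.2) f'.
Proof. by case=> df vf; split; [exact: df|exact: vf]. Qed.

End PairDerivatives.

Section PartialDerivatives.
Variables (R : realType) (V1 V2 W : normedModType R) (g : V1 * V2 -> W).

Lemma derive_snd x y v : 'D_(0, v) g (x, y) = 'D_v (fun z => g (x, z)) y.
Proof.
rewrite /derive; set g1 := fun h => h^-1 *: _; set g2 := fun h => h^-1 *: _.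
suff -> : g1 = g2 by []; apply/funext => h; rewrite /g1 /g2 /=.
rewrite (_ : h *: (0, v) + (x, y) = (x, h *: v + y)) //.
by congr (_, _); rewrite /= scaler0 add0r.
Qed.

Lemma derive_fst x y v : 'D_(v, 0) g (x, y) = 'D_v (fun z => g (z, y)) x.
Proof.
rewrite /derive; set g1 := fun h => h^-1 *: _; set g2 := fun h => h^-1 *: _.
suff -> : g1 = g2 by []; apply/funext => h; rewrite /g1 /g2 /=.
rewrite (_ : h *: (v, 0) + (x, y) = (h *: v + x, y)) //.
by congr (_, _); rewrite /= scaler0 add0r.
Qed.

End PartialDerivatives.

Lemma near_unitmx (R : realType) n (A : R -> 'M[R]_n) (t : R) A' :
  A t \in unitmx -> is_derive t (1 : R) A A' -> \forall x \near t, A x \in unitmx.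
Proof.
move=> Atu dA.
have cd : {for t, continuous (fun x => \det (A x) : R^o)}.
  apply/differentiable_continuous/derivable1_diffP.
  by case: (is_derive_det dA).
have d0 : \det (A t) != 0 by rewrite -unitfE -unitmxE.
have no : nbhs (\det (A t) : R^o) [set x | x != 0].
  by apply: open_nbhs_nbhs; split=> //; exact: open_neq.
have H : \forall x \near t, \det (A x) != 0 by exact: (cd _ no).
by move: H; apply: filterS => x x0; rewrite unitmxE unitfE.
Qed.

Lemma is_derive_invmx_at (R : realType) n (A : R -> 'M[R]_n) (t : R) A' :
  A t \in unitmx -> is_derive t (1 : R) A A' ->
  is_derive t (1 : R) (fun x => invmx (A x)) (- (invmx (A t) *m A' *m invmx (A t))).
Proof.
move=> Atu dA; pose B x := if A x \in unitmx then A x else 1%:M.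
have nu : \forall x \near t, A x = B x.
  by have := near_unitmx Atu dA; apply: filterS => x xu; rewrite /B xu.
have dB : is_derive t (1 : R) B A' by exact: near_eq_is_derive dA.
have Bu x : B x \in unitmx by rewrite /B; case: ifP => // _; exact: unitmx1.
have BE : B t = A t by rewrite /B Atu.
rewrite -BE; apply: near_eq_is_derive (is_derive_invmx Bu dB).
by move: nu; apply: filterS => x ->.
Qed.

(** * Lie groups and velocities of curves *)

Section LieGroupTheory.
Variables (R : realType) (n : nat) (G : lieData 'rV[R]_n).
Hypothesis hG : is_lie_group G.

Notation E := 'rV[R]_n.
Notation e := (gone G).
Notation phi := (cmap (chart1 G)).
Notation psi := (cinv (chart1 G)).
Notation z0 := (cmap (chart1 G) (gone G)).
Implicit Types (g h p : G).

Lemma lg_mulA g h p : gmul g (gmul h p) = gmul (gmul g h) p.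
Proof. by case: hG => -[]. Qed.

Lemma lg_mul1g g : gmul e g = g.
Proof. by case: hG => -[]. Qed.

Lemma lg_mulVg g : gmul (ginv g) g = e.
Proof. by case: hG => -[]. Qed.

Lemma lg_mulKg g h : gmul (ginv g) (gmul g h) = h.
Proof. by rewrite lg_mulA lg_mulVg lg_mul1g. Qed.

Lemma lg_mulgV g : gmul g (ginv g) = e.
Proof.
rewrite -[LHS](lg_mulKg (ginv g)) [X in gmul _ X](_ : _ = ginv g) ?lg_mulVg //.
by rewrite lg_mulA lg_mulVg lg_mul1g.
Qed.

Lemma lg_mulg1 g : gmul g e = g.
Proof. by rewrite -(lg_mulVg g) lg_mulA lg_mulgV lg_mul1g. Qed.

Lemma lg_mulgK g h : gmul (gmul h g) (ginv g) = h.
Proof. by rewrite -lg_mulA lg_mulgV lg_mulg1. Qed.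

Lemma lg_mulgKV g h : gmul (gmul h (ginv g)) g = h.
Proof. by rewrite -lg_mulA lg_mulVg lg_mulg1. Qed.

Lemma lg_mulVKg g h : gmul g (gmul (ginv g) h) = h.
Proof. by rewrite lg_mulA lg_mulgV lg_mul1g. Qed.

Lemma lg_invgK g : ginv (ginv g) = g.
Proof. by rewrite -[LHS]lg_mulg1 -(lg_mulVg g) lg_mulKg. Qed.

Lemma lg_invMg g h : ginv (gmul g h) = gmul (ginv h) (ginv g).
Proof.
by rewrite -[RHS](lg_mulKg (gmul g h)) (lg_mulA (gmul g h)) lg_mulgK lg_mulgV lg_mulg1.
Qed.

Lemma lg_mul_continuous : continuous (fun p : G * G => gmul p.1 p.2).
Proof. by case: hG => _ _ _ []. Qed.

Lemma lg_mull_continuous g : continuous (gmul g).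
Proof.
move=> h; have c : {for h, continuous (fun x : G => (g, x))}.
  by apply: cvg_pair; [exact: cvg_cst|exact: cvg_id].
exact: (continuous_comp c (@lg_mul_continuous (g, h))).
Qed.

Lemma lg_mulr_continuous g : continuous (fun h : G => gmul h g).
Proof.
move=> h; have c : {for h, continuous (fun x : G => (x, g))}.
  by apply: cvg_pair; [exact: cvg_id|exact: cvg_cst].
exact: (continuous_comp c (@lg_mul_continuous (h, g))).
Qed.

Lemma atlas_chart1 : atlas G (chart1 G).
Proof. by case: hG => _ _ []. Qed.

Lemma cdom_chart1 : cdom (chart1 G) e.
Proof. by case: hG => _ _ []. Qed.

Section Charts.
Variable a : chart E G.
Hypothesis aA : atlas G a.

Let ca : is_chart a.
Proof. by case: hG => _ [_ _ H _ _] _ _ _; exact: H. Qed.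

Lemma cinvK p : cdom a p -> cinv a (cmap a p) = p.
Proof. by case: ca => _ _ H _ _; exact: H. Qed.

Lemma cimg_cmap p : cdom a p -> cimg a (cmap a p).
Proof. by move=> ap; exists p. Qed.

Lemma cdom_cinv z : cimg a z -> cdom a (cinv a z).
Proof. by case=> p ap <-; rewrite cinvK. Qed.

Lemma cmapK z : cimg a z -> cmap a (cinv a z) = z.
Proof. by case=> p ap <-; rewrite cinvK. Qed.

Lemma open_cdom : open (cdom a). Proof. by case: ca. Qed.

Lemma open_cimg : open (cimg a). Proof. by case: ca. Qed.

Lemma nbhs_cdom p : cdom a p -> nbhs p (cdom a).
Proof. by move=> ap; apply: open_nbhs_nbhs; split=> //; exact: open_cdom. Qed.

Lemma nbhs_cimg z : cimg a z -> nbhs z (cimg a).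
Proof. by move=> az; apply: open_nbhs_nbhs; split=> //; exact: open_cimg. Qed.

Lemma cmap_continuous p : cdom a p -> {for p, continuous (cmap a)}.
Proof. by case: ca => _ _ _ H _; exact: H. Qed.

Lemma cinv_continuous z : cimg a z -> {for z, continuous (cinv a)}.
Proof. by case: ca => _ _ _ _ H; exact: H. Qed.

End Charts.

Lemma exists_chart p : exists2 a, atlas G a & cdom a p.
Proof. by case: hG => _ [_ _ _ H _] _ _ _; exact: H. Qed.

Lemma psi_z0 : psi z0 = e.
Proof. exact: cinvK atlas_chart1 _ cdom_chart1. Qed.

Lemma cimg_z0 : cimg (chart1 G) z0.
Proof. exact: cimg_cmap cdom_chart1. Qed.

(** Asking for all pairs of charts makes the composition of such maps a matter
    of inserting one intermediate chart. *)
Definition gdiff (T : G -> G) p : Prop :=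
  {for p, continuous T} /\
  forall a b, atlas G a -> atlas G b -> cdom a p -> cdom b (T p) ->
    differentiable (cmap b \o T \o cinv a) (cmap a p).

Lemma gdiff_comp (S T : G -> G) p : gdiff T p -> gdiff S (T p) -> gdiff (S \o T) p.
Proof.
move=> [cT dT] [cS dS]; split; first exact: continuous_comp.
move=> a b aA bA ap bp; have [d dA dTp] := exists_chart (T p).
have H1 := dT a d aA dA ap dTp; have H2 := dS d b dA bA dTp bp.
have H3 : differentiable ((cmap b \o S \o cinv d) \o (cmap d \o T \o cinv a)) (cmap a p).
  apply: differentiable_comp; first exact: H1.
  by move: H2; rewrite /= cinvK.
apply: near_eq_differentiable H3.
have ca : {for cmap a p, continuous (T \o cinv a)}.
  apply: continuous_comp; first exact: cinv_continuous (cimg_cmap ap).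
  by rewrite cinvK.
have nd : nbhs ((T \o cinv a) (cmap a p)) (cdom d) by rewrite /= cinvK //; exact: nbhs_cdom.
have H : \forall z \near cmap a p, cdom d (T (cinv a z)) by exact: (ca _ nd).
by move: H; apply: filterS => z /= dz; rewrite cinvK.
Qed.

(** A translation is the multiplication in charts restricted to a slice. *)
Lemma gdiff_mull g p : gdiff (gmul g) p.
Proof.
split; first exact: lg_mull_continuous.
move=> a b aA bA ap bp; have [d dA dg] := exists_chart g.
have [_ sm] : mul_smooth G by case: hG.
have /smooth_differentiable/(_ _)/= H := sm d a b dA aA bA.
have {}H := H (cmap d g, cmap a p); rewrite /= !cinvK // in H.
have {}H := H (And3 (cimg_cmap dg) (cimg_cmap ap) bp).
have dp : differentiable (fun z : E => (cmap d g, z)) (cmap a p).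
  by apply: differentiable_pair; [exact: differentiable_cst|exact: ex_diff].
have := differentiable_comp dp H.
set f1 := (_ \o _); set f2 := (cmap b \o _ \o _); suff -> : f1 = f2 by [].
by apply/funext => z; rewrite /f1 /f2 /= cinvK.
Qed.

Lemma gdiff_mulr g p : gdiff (fun h : G => gmul h g) p.
Proof.
split; first exact: lg_mulr_continuous.
move=> a b aA bA ap bp; have [d dA dg] := exists_chart g.
have [_ sm] : mul_smooth G by case: hG.
have /smooth_differentiable/(_ _)/= H := sm a d b aA dA bA.
have {}H := H (cmap a p, cmap d g); rewrite /= !cinvK // in H.
have {}H := H (And3 (cimg_cmap ap) (cimg_cmap dg) bp).
have dp : differentiable (fun z : E => (z, cmap d g)) (cmap a p).
  by apply: differentiable_pair; [exact: ex_diff|exact: differentiable_cst].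
have := differentiable_comp dp H.
set f1 := (_ \o _); set f2 := (cmap b \o _ \o _); suff -> : f1 = f2 by [].
by apply/funext => z; rewrite /f1 /f2 /= cinvK.
Qed.

Lemma gdiff_curve (T : G -> G) (c : R -> G) (t : R) a b v :
  {for t, continuous c} -> gdiff T (c t) -> atlas G a -> atlas G b ->
  cdom a (c t) -> cdom b (T (c t)) ->
  is_derive t (1 : R) (cmap a \o c) v ->
  is_derive t (1 : R) (cmap b \o T \o c) ('D_v (cmap b \o T \o cinv a) (cmap a (c t))).
Proof.
move=> cc [_ dT] aA bA ac bc dc.
have := is_derive_curve dc (dT a b aA bA ac bc).
apply: near_eq_is_derive.
have H : \forall s \near t, cdom a (c s) by exact: (cc _ (nbhs_cdom aA ac)).
by move: H; apply: filterS => s /= as_; rewrite cinvK.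
Qed.

Lemma fun_curve (V : normedModType R) (f : G -> V) (c : R -> G) (t : R) a v :
  {for t, continuous c} -> atlas G a -> cdom a (c t) ->
  differentiable (f \o cinv a) (cmap a (c t)) ->
  is_derive t (1 : R) (cmap a \o c) v ->
  is_derive t (1 : R) (f \o c) ('D_v (f \o cinv a) (cmap a (c t))).
Proof.
move=> cc aA ac df dc; have := is_derive_curve dc df.
apply: near_eq_is_derive.
have H : \forall s \near t, cdom a (c s) by exact: (cc _ (nbhs_cdom aA ac)).
by move: H; apply: filterS => s /= as_; rewrite cinvK.
Qed.

(** The velocity of [c] at [t], left or right translated to the identity.
    Translating the curve rather than its tangent vector allows a single chart,
    the one at the identity, to be used throughout. *)
Definition lvel (c : R -> G) (t : R) (u : E) : Prop :=
  {for t, continuous c} /\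
  is_derive t (1 : R) (fun s => phi (gmul (ginv (c t)) (c s))) u.

Definition rvel (c : R -> G) (t : R) (w : E) : Prop :=
  {for t, continuous c} /\
  is_derive t (1 : R) (fun s => phi (gmul (c s) (ginv (c t)))) w.

Lemma lvel_chart c t u a : lvel c t u -> atlas G a -> cdom a (c t) ->
  is_derive t (1 : R) (cmap a \o c) (lderiv (c t) u (cmap a)).
Proof.
move=> [cc dc] aA ac.
pose c1 s := gmul (ginv (c t)) (c s).
have c1t : c1 t = e by exact: lg_mulVg.
have cc1 : {for t, continuous c1}.
  exact: (continuous_comp cc (@lg_mull_continuous (ginv (c t)) (c t))).
have := @gdiff_curve (gmul (c t)) c1 t (chart1 G) a u cc1 (gdiff_mull _ _) atlas_chart1 aA.
rewrite c1t lg_mulg1 => /(_ cdom_chart1 ac dc).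
have -> : cmap a \o gmul (c t) \o c1 = cmap a \o c.
  by apply/funext => s /=; rewrite /c1 lg_mulVKg.
by [].
Qed.

(** A curve through the identity with velocity [x]; it is straight in the chart,
    and not a one-parameter subgroup. *)
Definition line (x : E) (s : R) : G := psi (z0 + s *: x).

Lemma line0 x : line x 0 = e.
Proof. by rewrite /line scale0r addr0 psi_z0. Qed.

Lemma line_cimg x : \forall s \near 0, cimg (chart1 G) (z0 + s *: x).
Proof.
have cl : {for (0 : R), continuous (fun s : R => z0 + s *: x)}.
  apply/differentiable_continuous/derivable1_diffP.
  by case: (is_derive_line z0 x 0).
apply: cl; rewrite scale0r addr0; exact: nbhs_cimg atlas_chart1 _ cimg_z0.
Qed.

Lemma line_continuous x : {for 0, continuous (line x)}.
Proof.
have cl : {for (0 : R), continuous (fun s : R => z0 + s *: x)}.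
  apply/differentiable_continuous/derivable1_diffP.
  by case: (is_derive_line z0 x 0).
apply: (continuous_comp cl); rewrite /= scale0r addr0.
exact: cinv_continuous atlas_chart1 _ cimg_z0.
Qed.

Lemma line_derive x : is_derive 0 (1 : R) (phi \o line x) x.
Proof.
apply: near_eq_is_derive (is_derive_line z0 x 0).
by have := line_cimg x; apply: filterS => s H; rewrite /= cmapK // ; exact: atlas_chart1.
Qed.

(** Translating back to the identity inverts the differential of the translation
    by [c t]: both sides are compared on the translate of [line u]. *)
Lemma chart_lvel c t u a : {for t, continuous c} -> atlas G a -> cdom a (c t) ->
  is_derive t (1 : R) (cmap a \o c) (lderiv (c t) u (cmap a)) -> lvel c t u.
Proof.
move=> cc aA ac dc; split=> //.
pose T := gmul (ginv (c t)); pose l s := gmul (c t) (line u s).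
have l0 : l 0 = c t by rewrite /l line0 lg_mulg1.
have cl : {for 0, continuous l}.
  by apply: (continuous_comp (@line_continuous u)); exact: lg_mull_continuous.
have dl : is_derive 0 (1 : R) (cmap a \o l) (lderiv (c t) u (cmap a)).
  have := @gdiff_curve (gmul (c t)) (line u) 0 (chart1 G) a u (@line_continuous u) (gdiff_mull _ _) atlas_chart1 aA.
  by rewrite line0 lg_mulg1 => /(_ cdom_chart1 ac (line_derive u)).
have dT := @gdiff_curve T c t a (chart1 G) _ cc (gdiff_mull _ _) aA atlas_chart1 ac.
rewrite /T lg_mulVg in dT; have {}dT := dT _ cdom_chart1 dc.
have dTl := @gdiff_curve T l 0 a (chart1 G) _ cl (gdiff_mull _ _) aA atlas_chart1.
rewrite l0 /T lg_mulVg in dTl; have {}dTl := dTl _ ac cdom_chart1 dl.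
have : is_derive 0 (1 : R) (phi \o gmul (ginv (c t)) \o l) u.
  have -> : phi \o gmul (ginv (c t)) \o l = phi \o line u.
    by apply/funext => s /=; rewrite /l lg_mulKg.
  exact: line_derive.
by case=> _; case: dTl => _ -> Eu; rewrite -[X in is_derive _ _ _ X]Eu.
Qed.

Lemma is_derive_unique (V : normedModType R) (f : R -> V) (t : R) (a b : V) :
  is_derive t (1 : R) f a -> is_derive t (1 : R) f b -> a = b.
Proof. by case=> _ <- [_ <-]. Qed.

(** The mirror image of [chart_lvel]. *)
Lemma rvel_chart c t w : {for t, continuous c} -> cdom (chart1 G) (c t) ->
  is_derive t (1 : R) (phi \o c)
    ('D_w (phi \o (fun h : G => gmul h (c t)) \o psi) z0) -> rvel c t w.
Proof.
move=> cc ac dc; split=> //.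
pose T (h : G) := gmul h (ginv (c t)); pose l s := gmul (line w s) (c t).
have l0 : l 0 = c t by rewrite /l line0 lg_mul1g.
have cl : {for 0, continuous l}.
  exact: (continuous_comp (@line_continuous w) (@lg_mulr_continuous (c t) _)).
have dl := @gdiff_curve (fun h => gmul h (c t)) (line w) 0 (chart1 G) (chart1 G) w
  (@line_continuous w) (gdiff_mulr _ _) atlas_chart1 atlas_chart1.
rewrite line0 lg_mul1g in dl; have {}dl := dl cdom_chart1 ac (line_derive w).
have dT := @gdiff_curve T c t (chart1 G) (chart1 G) _ cc (gdiff_mulr _ _) atlas_chart1 atlas_chart1 ac.
rewrite /T lg_mulgV in dT; have {}dT := dT _ cdom_chart1 dc.
have dTl := @gdiff_curve T l 0 (chart1 G) (chart1 G) _ cl (gdiff_mulr _ _) atlas_chart1 atlas_chart1.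
rewrite l0 /T lg_mulgV in dTl; have {}dTl := dTl _ ac cdom_chart1 dl.
have : is_derive 0 (1 : R) (phi \o (fun h : G => gmul h (ginv (c t))) \o l) w.
  have -> : phi \o (fun h : G => gmul h (ginv (c t))) \o l = phi \o line w.
    by apply/funext => s /=; rewrite /l lg_mulgK.
  exact: line_derive.
by move=> /(is_derive_unique dTl) <-.
Qed.

(** * The adjoint representation *)

Lemma gdiff_conj g p : gdiff (fun h => gmul (gmul g h) (ginv g)) p.
Proof.
exact: (gdiff_comp (gdiff_mull g p) (gdiff_mulr (ginv g) (gmul g p))).
Qed.

Lemma conj_e g : gmul (gmul g e) (ginv g) = e.
Proof. by rewrite lg_mulg1 lg_mulgV. Qed.

Lemma Ad_curve g c t v : {for t, continuous c} -> c t = e ->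
  is_derive t (1 : R) (phi \o c) v ->
  is_derive t (1 : R) (fun s => phi (gmul (gmul g (c s)) (ginv g))) (Ad g v).
Proof.
move=> cc ce dc.
have := @gdiff_curve _ c t (chart1 G) (chart1 G) v cc (gdiff_conj g _) atlas_chart1 atlas_chart1.
by rewrite ce conj_e => /(_ cdom_chart1 cdom_chart1 dc).
Qed.

Lemma Ad_differentiable g :
  differentiable (fun z => phi (gmul (gmul g (psi z)) (ginv g))) z0.
Proof.
have [_ /(_ _ _ atlas_chart1 atlas_chart1 cdom_chart1)] := gdiff_conj g e.
by rewrite conj_e => /(_ cdom_chart1).
Qed.

Lemma Ad_lin g a x y : Ad g (a *: x + y) = a *: Ad g x + Ad g y.
Proof. by rewrite /Ad !deriveE ?linearP //; exact: Ad_differentiable. Qed.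

(** Since matrices act on rows, [AdM] reverses products: see [AdM_mul]. *)
Definition AdM g : 'M[R]_n := lin1_mx (Ad g).

Lemma mul_AdM g x : x *m AdM g = Ad g x.
Proof. by apply: mul_rV_lin1P => *; exact: Ad_lin. Qed.

Lemma Ad_mul g h x : Ad (gmul g h) x = Ad g (Ad h x).
Proof.
have dh := Ad_curve h (@line_continuous x) (line0 x) (line_derive x).
have ch : {for 0, continuous (fun s => gmul (gmul h (line x s)) (ginv h))}.
  have [c _] := gdiff_conj h e.
  have cl := @line_continuous x; rewrite -(line0 x) in c.
  exact: (continuous_comp cl c).
have he : gmul (gmul h (line x 0)) (ginv h) = e by rewrite line0 conj_e.
apply: (is_derive_unique _ (Ad_curve g ch he dh)).
have := Ad_curve (gmul g h) (@line_continuous x) (line0 x) (line_derive x).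
by congr is_derive; apply/funext => s; rewrite lg_invMg !lg_mulA.
Qed.

Lemma Ad1 x : Ad e x = x.
Proof.
have := Ad_curve e (@line_continuous x) (line0 x) (line_derive x).
move=> /is_derive_unique; apply.
have := line_derive x; congr is_derive; apply/funext => s /=.
by rewrite lg_mul1g -(lg_mul1g (ginv e)) lg_mulgV lg_mulg1.
Qed.

Lemma AdM_mul g h : AdM (gmul g h) = AdM h *m AdM g.
Proof. by apply/row_matrixP => i; rewrite !rowE mulmxA !mul_AdM Ad_mul. Qed.

Lemma AdM1 : AdM e = 1%:M.
Proof. by apply/row_matrixP => i; rewrite !rowE mul_AdM Ad1 mulmx1. Qed.

Lemma AdM_unit g : AdM g \in unitmx.
Proof.
have H : AdM g *m AdM (ginv g) = 1%:M by rewrite -AdM_mul lg_mulVg AdM1.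
exact: (mulmx1_unit H).1.
Qed.

(** [c t ^-1 c s] is the conjugate by [c t ^-1] of [c s c t ^-1]. *)
Lemma rvel_lvel c t w : rvel c t w -> lvel c t (Ad (ginv (c t)) w).
Proof.
move=> [cc dc]; split; first exact: cc.
have cc1 : {for t, continuous (fun s => gmul (c s) (ginv (c t)))}.
  exact: (continuous_comp cc (@lg_mulr_continuous (ginv (c t)) _)).
have := Ad_curve (ginv (c t)) cc1 (lg_mulgV _) dc.
by under eq_fun do rewrite lg_invgK lg_mulA lg_mulgKV.
Qed.

(** The multiplication in the chart, one coordinate at a time because
    [derive_comm] is about real valued functions. *)
Let m (j : 'I_n) (z : E * E) : R^o := phi (gmul (psi z.1) (psi z.2)) 0 j.
Let U : set (E * E) := [set z | [/\ cimg (chart1 G) z.1, cimg (chart1 G) z.2 &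
   cdom (chart1 G) (gmul (psi z.1) (psi z.2))]].

Lemma open_mul_dom : open U.
Proof.
rewrite openE => z [z1 z2 z12].
have f1 : {for z, continuous (fun z : E * E => z.1)}.
  by move: z {z1 z2 z12} => [x y]; exact: cvg_fst.
have f2 : {for z, continuous (fun z : E * E => z.2)}.
  by move: z {z1 z2 z12 f1} => [x y]; exact: cvg_snd.
have c1 : {for z, continuous (fun z : E * E => psi z.1)}.
  exact: (continuous_comp f1 (cinv_continuous atlas_chart1 z1)).
have c2 : {for z, continuous (fun z : E * E => psi z.2)}.
  exact: (continuous_comp f2 (cinv_continuous atlas_chart1 z2)).
have c12 : {for z, continuous (fun z : E * E => gmul (psi z.1) (psi z.2))}.
  have cp : {for z, continuous (fun z : E * E => (psi z.1, psi z.2))}.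
    exact: cvg_pair c1 c2.
  exact: (continuous_comp cp (@lg_mul_continuous _)).
have n1 : \forall z' \near z, cimg (chart1 G) z'.1.
  exact: (f1 _ (nbhs_cimg atlas_chart1 z1)).
have n2 : \forall z' \near z, cimg (chart1 G) z'.2.
  exact: (f2 _ (nbhs_cimg atlas_chart1 z2)).
have n12 : \forall z' \near z, cdom (chart1 G) (gmul (psi z'.1) (psi z'.2)).
  exact: (c12 _ (nbhs_cdom atlas_chart1 z12)).
by near=> z'; split; [near: z'|near: z'|near: z'].
Unshelve. all: by end_near. Qed.

Lemma smooth_m j : smooth U (m j).
Proof.
have [_ sm] : mul_smooth G by case: hG.
exact: (smooth_entry 0 j open_mul_dom (sm _ _ _ atlas_chart1 atlas_chart1 atlas_chart1)).
Qed.

Lemma U_z0l z : cimg (chart1 G) z -> U (z0, z).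
Proof.
move=> az; split; [exact: cimg_z0|exact: az|].
by rewrite /= psi_z0 lg_mul1g; exact: (cdom_cinv atlas_chart1).
Qed.

Lemma U_z0r z : cimg (chart1 G) z -> U (z, z0).
Proof.
move=> az; split; [exact: az|exact: cimg_z0|].
by rewrite /= psi_z0 lg_mulg1; exact: (cdom_cinv atlas_chart1).
Qed.

(** [RM z] and [LM z]: the differentials at the identity of the right and left
    translations by [psi z], in the chart *)
Definition RM (z : E) : 'M[R]_n := \matrix_(i, j) 'D_(delta_mx 0 i, 0) (m j) (z0, z).
Definition LM (z : E) : 'M[R]_n := \matrix_(i, j) 'D_(0, delta_mx 0 i) (m j) (z, z0).

Lemma mul_RM z x : cimg (chart1 G) z ->
  x *m RM z = 'D_x (phi \o (fun h : G => gmul h (psi z)) \o psi) z0.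
Proof.
move=> az.
have [_ /(_ _ _ atlas_chart1 atlas_chart1 cdom_chart1)] := gdiff_mulr (psi z) e.
rewrite lg_mul1g => /(_ (cdom_cinv atlas_chart1 az)) df.
rewrite derive_rV //; apply/rowP => j; rewrite mxE summxE; apply: eq_bigr => i _.
rewrite !mxE; congr (_ * _); rewrite derive_mx ?mxE; last exact: diff_derivable.
by rewrite derive_fst.
Qed.

Lemma mul_LM z x : cimg (chart1 G) z ->
  x *m LM z = 'D_x (phi \o gmul (psi z) \o psi) z0.
Proof.
move=> az.
have [_ /(_ _ _ atlas_chart1 atlas_chart1 cdom_chart1)] := gdiff_mull (psi z) e.
rewrite lg_mulg1 => /(_ (cdom_cinv atlas_chart1 az)) df.
rewrite derive_rV //; apply/rowP => j; rewrite mxE summxE; apply: eq_bigr => i _.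
rewrite !mxE; congr (_ * _); rewrite derive_mx ?mxE; last exact: diff_derivable.
by rewrite derive_snd.
Qed.

(** [g psi(s) = (g psi(s) g^-1) g]: the left translation by [g] is the right
    translation by [g] after conjugation. *)
Lemma AdM_RM z : cimg (chart1 G) z -> AdM (psi z) *m RM z = LM z.
Proof.
move=> az; apply/row_matrixP => i; rewrite !rowE mulmxA mul_AdM mul_RM // mul_LM //.
set y := delta_mx 0 i : 'rV[R]_n; set g := psi z.
have ag : cdom (chart1 G) g by exact: (cdom_cinv atlas_chart1).
have cl := @line_continuous y.
have dA := Ad_curve g cl (line0 y) (line_derive y).
have cA : {for 0, continuous (fun s => gmul (gmul g (line y s)) (ginv g))}.
  have [c _] := gdiff_conj g e; rewrite -(line0 y) in c.
  exact: (continuous_comp cl c).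
have dR := @gdiff_curve (fun h => gmul h g) _ 0 (chart1 G) (chart1 G) _ cA (gdiff_mulr _ _) atlas_chart1 atlas_chart1.
rewrite line0 conj_e lg_mul1g in dR; have {}dR := dR _ cdom_chart1 ag dA.
have dL := @gdiff_curve (gmul g) _ 0 (chart1 G) (chart1 G) _ cl (gdiff_mull _ _) atlas_chart1 atlas_chart1.
rewrite line0 lg_mulg1 in dL; have {}dL := dL _ cdom_chart1 ag (line_derive y).
apply: (is_derive_unique dR); move: dL; congr is_derive.
by apply/funext => s /=; rewrite lg_mulgKV.
Qed.

Lemma RM_z0 : RM z0 = 1%:M.
Proof.
apply/row_matrixP => i; rewrite !rowE mulmx1 mul_RM; last exact: cimg_z0.
have H : \forall z \near z0, z = (phi \o (fun h : G => gmul h (psi z0)) \o psi) z.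
  have := nbhs_cimg atlas_chart1 cimg_z0; apply: filterS => z az /=.
  by rewrite psi_z0 lg_mulg1 cmapK //; exact: atlas_chart1.
by rewrite -(near_eq_derive _ H) derive_id.
Qed.

Lemma LM_z0 : LM z0 = 1%:M.
Proof. by rewrite -AdM_RM ?psi_z0 ?AdM1 ?RM_z0 ?mulmx1 //; exact: cimg_z0. Qed.

Lemma RM_differentiable z : cimg (chart1 G) z -> differentiable RM z.
Proof.
move=> az; apply: differentiable_mx => i j.
have sm := smooth_derive (delta_mx 0 i, 0) (smooth_m j).
have d1 := smooth_differentiable sm (U_z0l az).
have dp : differentiable (fun z : E => (z0, z)) z.
  by apply: differentiable_pair; [exact: differentiable_cst|exact: ex_diff].
have := differentiable_comp dp d1.
set f1 := _ \o _; set f2 := (fun z => _); suff -> : f1 = f2 by [].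
by apply/funext => x; rewrite /f1 /f2 mxE.
Qed.

Lemma LM_differentiable z : cimg (chart1 G) z -> differentiable LM z.
Proof.
move=> az; apply: differentiable_mx => i j.
have sm := smooth_derive (0, delta_mx 0 i) (smooth_m j).
have d1 := smooth_differentiable sm (U_z0r az).
have dp : differentiable (fun z : E => (z, z0)) z.
  by apply: differentiable_pair; [exact: ex_diff|exact: differentiable_cst].
have := differentiable_comp dp d1.
set f1 := _ \o _; set f2 := (fun z => _); suff -> : f1 = f2 by [].
by apply/funext => x; rewrite /f1 /f2 mxE.
Qed.

Lemma derive_RM z v i j : cimg (chart1 G) z ->
  ('D_v RM z) i j = 'D_(0, v) ('D_(delta_mx 0 i, 0) (m j)) (z0, z).
Proof.
move=> az; rewrite derive_mx ?mxE; last exact/diff_derivable/RM_differentiable.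
by rewrite derive_snd; congr ('D_v _ z); apply/funext => y; rewrite mxE.
Qed.

Lemma derive_RM_continuous v : {for z0, continuous ('D_v RM)}.
Proof.
apply: continuous_mxP => i j.
have sm := smooth_derive (0, v) (smooth_derive (delta_mx 0 i, 0) (smooth_m j)).
have c1 := smooth_continuous sm (U_z0l cimg_z0).
have cp : {for z0, continuous (fun z : E => (z0, z))}.
  apply: differentiable_continuous; apply: differentiable_pair.
    exact: differentiable_cst.
  exact: ex_diff.
have c2 : {for z0, continuous (fun z : E => 'D_(0, v) ('D_(delta_mx 0 i, 0) (m j)) (z0, z))}.
  exact: (continuous_comp cp c1).
apply: near_eq_continuous c2.
have := nbhs_cimg atlas_chart1 cimg_z0; apply: filterS => z az.
by rewrite derive_RM.
Qed.
(** The derivative of [AdM] at the identity, obtained from [AdM_RM] where both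
    factors are the identity matrix: see [AdM_curve]. *)
Definition adM (u : E) : 'M[R]_n := 'D_u LM z0 - 'D_u RM z0.

Lemma AdM_curve c t u : {for t, continuous c} -> c t = e ->
  is_derive t (1 : R) (phi \o c) u -> is_derive t (1 : R) (AdM \o c) (adM u).
Proof.
move=> cc ce dc.
have zt : (phi \o c) t = z0 by rewrite /= ce.
have dR : is_derive t (1 : R) (RM \o (phi \o c)) ('D_u RM z0).
  have := @is_derive_curve _ _ _ RM _ _ _ dc.
  by rewrite zt; apply; exact: RM_differentiable cimg_z0.
have dL : is_derive t (1 : R) (LM \o (phi \o c)) ('D_u LM z0).
  have := @is_derive_curve _ _ _ LM _ _ _ dc.
  by rewrite zt; apply; exact: LM_differentiable cimg_z0.
have R1 : (RM \o (phi \o c)) t = 1%:M by rewrite [LHS]/= ce; exact: RM_z0.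
have L1 : (LM \o (phi \o c)) t = 1%:M by rewrite [LHS]/= ce; exact: LM_z0.
have Ru : (RM \o (phi \o c)) t \in unitmx by rewrite R1 unitmx1.
have := is_derive_mulmx dL (is_derive_invmx_at Ru dR).
rewrite R1 L1 invmx1 !mulmx1 !mul1mx; apply: near_eq_is_derive.
have H : \forall s \near t, cdom (chart1 G) (c s).
  by apply: cc; rewrite ce; exact: nbhs_cdom atlas_chart1 _ cdom_chart1.
move: H (near_unitmx Ru dR); apply: filterS2 => s as_ us.
have := AdM_RM (cimg_cmap as_); rewrite (cinvK atlas_chart1 as_) => EL.
by rewrite /= -EL mulmxK.
Qed.

Lemma mul_derive_LM x y j :
  (y *m 'D_x LM z0) 0 j = 'D_(x, 0) ('D_(0, y) (m j)) (z0, z0).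
Proof.
have dL : derivable LM z0 x by exact: diff_derivable (LM_differentiable cimg_z0).
have := is_derive_mulmx (is_derive_cst y z0 x) (derivableP dL).
rewrite mul0mx add0r => /is_derive_mxP /(_ 0 j) [_ <-].
rewrite derive_fst; apply: near_eq_derive.
have := nbhs_cimg atlas_chart1 cimg_z0; apply: filterS => z az.
have [_ /(_ _ _ atlas_chart1 atlas_chart1 cdom_chart1)] := gdiff_mull (psi z) e.
rewrite lg_mulg1 => /(_ (cdom_cinv atlas_chart1 az)) df.
rewrite [LHS](_ : _ = (y *m LM z) 0 j) // (mul_LM y az).
rewrite derive_mx ?mxE; last exact: diff_derivable.
by rewrite derive_snd.
Qed.

Lemma mul_derive_RM x y j :
  (y *m 'D_x RM z0) 0 j = 'D_(0, x) ('D_(y, 0) (m j)) (z0, z0).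
Proof.
have dL : derivable RM z0 x by exact: diff_derivable (RM_differentiable cimg_z0).
have := is_derive_mulmx (is_derive_cst y z0 x) (derivableP dL).
rewrite mul0mx add0r => /is_derive_mxP /(_ 0 j) [_ <-].
rewrite derive_snd; apply: near_eq_derive.
have := nbhs_cimg atlas_chart1 cimg_z0; apply: filterS => z az.
have [_ /(_ _ _ atlas_chart1 atlas_chart1 cdom_chart1)] := gdiff_mulr (psi z) e.
rewrite lg_mul1g => /(_ (cdom_cinv atlas_chart1 az)) df.
rewrite [LHS](_ : _ = (y *m RM z) 0 j) // (mul_RM y az).
rewrite derive_mx ?mxE; last exact: diff_derivable.
by rewrite derive_fst.
Qed.

(** Differentiating [RM] produces the partial derivatives in the opposite order;
    they commute by [derive_comm]. *)
Lemma mul_adM x y j : (y *m adM x) 0 j =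
  'D_(x, 0) ('D_(0, y) (m j)) (z0, z0) - 'D_(y, 0) ('D_(0, x) (m j)) (z0, z0).
Proof.
have mulB (A B : 'M[R]_n) : (y *m (A - B)) 0 j = (y *m A) 0 j - (y *m B) 0 j.
  by rewrite mulmxBr !mxE.
have Uz : U (z0, z0) := U_z0l cimg_z0.
have sm u v := smooth_derive u (smooth_derive v (smooth_m j)).
have nU : nbhs (z0, z0) U by apply: open_nbhs_nbhs; split; [exact: open_mul_dom|].
have sym : 'D_(0, x) ('D_(y, 0) (m j)) (z0, z0) = 'D_(y, 0) ('D_(0, x) (m j)) (z0, z0).
  apply: derive_comm.
  - apply: filterS nU => q Uq; split.
    + exact: smooth_differentiable (smooth_m j) Uq.
    + exact: smooth_differentiable (smooth_derive _ (smooth_m j)) Uq.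
    + exact: smooth_differentiable (smooth_derive _ (smooth_m j)) Uq.
  - exact: (smooth_continuous (sm _ _) Uz).
  - exact: (smooth_continuous (sm _ _) Uz).
exact: (etrans (mulB _ _) (congr2 (fun a b : R => a - b) (mul_derive_LM x y j) (etrans (mul_derive_RM x y j) sym))).
Qed.

Lemma smooth_coord_chart1 j : smooth_on (cdom (chart1 G)) (fun g => phi g 0 j : R^o).
Proof.
move=> c cA.
have sT : smooth (cmap c @` (cdom c `&` cdom (chart1 G))) (phi \o cinv c).
  by case: hG => _ [_ _ _ _ H] _ _ _; apply: H => //; exact: atlas_chart1.
have UE : [set z | cimg c z /\ cdom (chart1 G) (cinv c z)] =
   cmap c @` (cdom c `&` cdom (chart1 G)).
  apply/seteqP; split=> z /=.
    by case=> az bz; exists (cinv c z); [split=> //; exact: cdom_cinv|exact: cmapK].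
  by case=> p [ap bp] <-; split; [exact: cimg_cmap|rewrite cinvK].
rewrite UE; apply: (smooth_entry 0 j _ sT); rewrite -UE openE => z [az bz].
have n1 := nbhs_cimg cA az.
have n2 : \forall y \near z, cdom (chart1 G) (cinv c y).
  exact: (cinv_continuous cA az (nbhs_cdom atlas_chart1 bz)).
exact: filterI n1 n2.
Qed.

(** The bracket, tested on the coordinates of the chart, is the antisymmetrised
    mixed derivative of the multiplication that appears in [mul_adM]. *)
Lemma adM_bracket x y (Z : G -> E) : is_bracket (cst x) (cst y) Z ->
  y *m adM x = Z e.
Proof.
move=> brZ; apply/rowP => j; rewrite mul_adM.
have := brZ _ _ (open_cdom atlas_chart1) (@smooth_coord_chart1 j) e cdom_chart1.
have V2 u v : vact (cst u) (vact (cst v) (fun g => phi g 0 j)) e =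
  'D_(u, 0) ('D_(0, v) (m j)) (z0, z0).
  rewrite derive_fst /vact /lderiv /cst; congr ('D_u _ z0).
  by apply/funext => z; rewrite derive_snd lg_mul1g.
rewrite !V2 => <-; rewrite /vact /lderiv.
have H : \forall z \near z0, (fun z : E => z 0 j : R^o) z = phi (gmul e (psi z)) 0 j.
  have := nbhs_cimg atlas_chart1 cimg_z0; apply: filterS => z az.
  by rewrite lg_mul1g (cmapK atlas_chart1 az).
rewrite -(near_eq_derive _ H).
by have /is_derive_mxP /(_ 0 j) [_ ->] := is_derive_id z0 (Z e).
Qed.

(** Differentiability at the identity along curves is enough for the chain rules
    below, and avoids a Frechet derivative for [AdM], which involves an inverse
    matrix. *)
Definition curve_diff k (f : G -> 'M[R]_k) (df : E -> 'M[R]_k) : Prop :=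
  forall c t u, {for t, continuous c} -> c t = e ->
    is_derive t (1 : R) (phi \o c) u -> is_derive t (1 : R) (f \o c) (df u).

Lemma smooth_curve_diff k (f : G -> 'M[R]_k) : smooth_on setT f ->
  curve_diff f (fun u => lderiv e u f).
Proof.
move=> sf c t u cc ce dc.
have df : differentiable (f \o psi) z0.
  by apply: smooth_differentiable (sf _ atlas_chart1) _; split=> //; exact: cimg_z0.
have := @fun_curve _ f c t (chart1 G) u cc atlas_chart1.
rewrite ce => /(_ cdom_chart1 df dc).
by rewrite /lderiv; under [in X in _ -> X]eq_fun do rewrite lg_mul1g.
Qed.

Section Homomorphisms.
Variables (k : nat) (f : G -> 'M[R]_k) (df : E -> 'M[R]_k).
Hypothesis dfP : curve_diff f df.

Lemma hom_lvel c t u : (forall g h, f (gmul g h) = f g *m f h) -> lvel c t u ->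
  is_derive t (1 : R) (f \o c) (f (c t) *m df u).
Proof.
move=> fM [cc dc].
have cc1 : {for t, continuous (gmul (ginv (c t)) \o c)}.
  exact: (continuous_comp cc (@lg_mull_continuous _ _)).
have := is_derive_mulmx (is_derive_cst (f (c t)) t 1) (dfP cc1 (lg_mulVg _) dc).
rewrite mul0mx add0r; congr is_derive; apply/funext => s /=.
by rewrite -fM lg_mulVKg.
Qed.

Lemma antihom_lvel c t u : (forall g h, f (gmul g h) = f h *m f g) -> lvel c t u ->
  is_derive t (1 : R) (f \o c) (df u *m f (c t)).
Proof.
move=> fM [cc dc].
have cc1 : {for t, continuous (gmul (ginv (c t)) \o c)}.
  exact: (continuous_comp cc (@lg_mull_continuous _ _)).
have := is_derive_mulmx (dfP cc1 (lg_mulVg _) dc) (is_derive_cst (f (c t)) t 1).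
rewrite mulmx0 addr0; congr is_derive; apply/funext => s /=.
by rewrite -fM lg_mulVKg.
Qed.

Lemma hom_rvel c t w : (forall g h, f (gmul g h) = f g *m f h) -> rvel c t w ->
  is_derive t (1 : R) (f \o c) (df w *m f (c t)).
Proof.
move=> fM [cc dc].
have cc1 : {for t, continuous ((fun h : G => gmul h (ginv (c t))) \o c)}.
  exact: (continuous_comp cc (@lg_mulr_continuous _ _)).
have := is_derive_mulmx (dfP cc1 (lg_mulgV _) dc) (is_derive_cst (f (c t)) t 1).
rewrite mulmx0 addr0; congr is_derive; apply/funext => s /=.
by rewrite -fM lg_mulgKV.
Qed.

Lemma antihom_rvel c t w : (forall g h, f (gmul g h) = f h *m f g) -> rvel c t w ->
  is_derive t (1 : R) (f \o c) (f (c t) *m df w).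
Proof.
move=> fM [cc dc].
have cc1 : {for t, continuous ((fun h : G => gmul h (ginv (c t))) \o c)}.
  exact: (continuous_comp cc (@lg_mulr_continuous _ _)).
have := is_derive_mulmx (is_derive_cst (f (c t)) t 1) (dfP cc1 (lg_mulgV _) dc).
rewrite mul0mx add0r; congr is_derive; apply/funext => s /=.
by rewrite -fM lg_mulgKV.
Qed.

Lemma hom_conj g y : (forall g h, f (gmul g h) = f g *m f h) ->
  df (Ad g y) = f g *m df y *m f (ginv g).
Proof.
move=> fM; have cl := @line_continuous y.
have dA := Ad_curve g cl (line0 y) (line_derive y).
have cA : {for 0, continuous (fun s => gmul (gmul g (line y s)) (ginv g))}.
  have [c _] := gdiff_conj g e; rewrite -(line0 y) in c.
  exact: (continuous_comp cl c).
have eA : gmul (gmul g (line y 0)) (ginv g) = e by rewrite line0 conj_e.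
have d1 := dfP cA eA dA.
have d2 := is_derive_mulmx (is_derive_mulmx (is_derive_cst (f g) (0 : R) (1 : R))
  (dfP cl (line0 y) (line_derive y))) (is_derive_cst (f (ginv g)) (0 : R) (1 : R)).
rewrite mul0mx add0r mulmx0 addr0 in d2.
apply: (is_derive_unique d1); move: d2; congr is_derive.
by apply/funext => s /=; rewrite -!fM.
Qed.

End Homomorphisms.
(** * Global flows with prescribed right velocity *)

Lemma local_right_flow (B : R) : 0 <= B -> exists2 d, 0 < d &
  forall w : R -> E, continuous w -> (forall t, `|w t| <= B) ->
  exists c : R -> G, c 0 = e /\ forall t, `|t| < d -> rvel c t (w t).
Proof.
move=> B0.
have nR : \forall z \near z0, differentiable RM z.
  have := nbhs_cimg atlas_chart1 cimg_z0; apply: filterS => z az.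
  exact: RM_differentiable.
have [r1 [L [r10 L0 RL]]] := C1_lipschitz nR (fun k => @derive_RM_continuous _).
have [r2 /= r20 Hr2] := (nbhs_ballP z0 _).1 (nbhs_cimg atlas_chart1 cimg_z0).
pose r := Num.min r1 (r2 / 2).
have r0 : 0 < r by rewrite lt_min r10 divr_gt0.
have rr1 : r <= r1 by rewrite ge_min lexx.
have rimg z : `|z - z0| <= r -> cimg (chart1 G) z.
  move=> zr; apply: Hr2; rewrite -ball_normE /ball_ /= distrC.
  apply: le_lt_trans zr _; rewrite gt_min; apply/orP; right.
  by rewrite ltr_pdivrMr // ltr_pMr // ltr1n.
have RL' x y : `|x - z0| <= r -> `|y - z0| <= r -> `|RM x - RM y| <= L * `|x - y|.
  by move=> xr yr; apply: RL; [exact: le_trans xr rr1|exact: le_trans yr rr1].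
have RC x : `|x - z0| <= r -> `|RM x| <= L * r + `|RM z0|.
  move=> xr; rewrite -[RM x](subrK (RM z0)); apply: le_trans (ler_normD _ _) _.
  rewrite lerD2r; apply: le_trans (RL' _ _ xr _) _; last exact: ler_wpM2l.
  by rewrite subrr normr0 ltW.
have [d d0 Hd] := local_flow r0 L0 RL' RC B0.
exists d => // w cw wB; have [y [y0 yr dy]] := Hd w cw wB.
have ay t : cimg (chart1 G) (y t) by exact: rimg.
exists (psi \o y); split; first by rewrite /= y0 psi_z0.
move=> t td; apply: rvel_chart.
- have cy : {for t, continuous y}.
    by apply/differentiable_continuous/derivable1_diffP; case: (dy t td).
  exact: (continuous_comp cy (cinv_continuous atlas_chart1 (ay t))).
- exact: (cdom_cinv atlas_chart1 (ay t)).
- rewrite -(mul_RM (w t) (ay t)).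
  have := dy t td; congr is_derive.
  by apply/funext => s /=; rewrite (cmapK atlas_chart1 (ay s)).
Qed.

Lemma rvel_mulr c t w g : rvel c t w -> rvel (fun s => gmul (c s) g) t w.
Proof.
move=> [cc dc]; split; first exact: (continuous_comp cc (@lg_mulr_continuous g _)).
by move: dc; congr is_derive; apply/funext => s; rewrite lg_invMg lg_mulA lg_mulgK.
Qed.

Lemma lvel_mull c t u g : lvel c t u -> lvel (fun s => gmul g (c s)) t u.
Proof.
move=> [cc dc]; split; first exact: (continuous_comp cc (@lg_mull_continuous g _)).
move: dc; congr is_derive; apply/funext => s.
by rewrite lg_invMg -lg_mulA lg_mulKg.
Qed.

Lemma rvel_affine c (a k t : R) w :
  rvel c (a + k * t) w -> rvel (fun s => c (a + k * s)) t (k *: w).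
Proof.
move=> [cc [dc dw]].
have dl : is_derive t (1 : R) (fun s => a + k * s : R^o) (k *: (1 : R^o)).
  have := is_derive_line (a : R^o) (k *: (1 : R^o)) t; congr is_derive.
  by apply/funext => s /=; rewrite [k *: _]mulr1 mulrC.
have cl : {for t, continuous (fun s => a + k * s : R^o)}.
  by apply/differentiable_continuous/derivable1_diffP; case: dl.
split; first exact: (continuous_comp cl cc).
have df := (derivable1_diffP _ _).1 dc.
by have := is_derive_curve dl df; rewrite (derive_scale _ _ df) dw.
Qed.

Lemma near_rvel c c' t w : (\forall s \near t, c s = c' s) -> rvel c t w -> rvel c' t w.
Proof.
move=> cc' [cc dc]; split; first exact: near_eq_continuous cc' cc.
have E0 : c t = c' t by exact: nbhs_singleton cc'.
apply: near_eq_is_derive dc; rewrite -E0.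
by move: cc'; apply: filterS => s ->.
Qed.

Lemma is_derive_glue (V : normedModType R) (f1 f2 : R -> V) (t : R) (v : V) :
  f1 t = f2 t -> is_derive t (1 : R) f1 v -> is_derive t (1 : R) f2 v ->
  is_derive t (1 : R) (fun s => if s < t then f1 s else f2 s) v.
Proof.
move=> f12 [d1 v1] [d2 v2].
pose q (f : R -> V) (h : R) := h^-1 *: (f (h *: (1 : R) + t) - f t).
have c1 : q f1 h @[h --> 0^'] --> v by rewrite -v1; exact: d1.
have c2 : q f2 h @[h --> 0^'] --> v by rewrite -v2; exact: d2.
have c : q (fun s => if s < t then f1 s else f2 s) h @[h --> 0^'] --> v.
  apply/cvgrPdist_lt => eps eps0.
  move/cvgrPdist_lt : c1 => /(_ eps eps0) n1.
  move/cvgrPdist_lt : c2 => /(_ eps eps0) n2.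
  move: n1 n2; apply: filterS2 => h h1 h2.
  by rewrite /q ltxx; case: ifP => _; rewrite -?f12 // f12.
by split; [apply/cvg_ex; exists v|exact: cvg_lim].
Qed.

(** Both halves have the same value and the same velocity at [t], so that no
    uniqueness of solutions is involved. *)
Lemma rvel_glue c1 c2 t w : c1 t = c2 t -> rvel c1 t w -> rvel c2 t w ->
  rvel (fun s => if s < t then c1 s else c2 s) t w.
Proof.
move=> c12 [cc1 dc1] [cc2 dc2]; split.
  rewrite /prop_for /continuous_at ltxx => A nA.
  have n2 : \forall s \near t, A (c2 s) by exact: (cc2 _ nA).
  have n1 : \forall s \near t, A (c1 s) by rewrite -c12 in nA; exact: (cc1 _ nA).
  by move: n1 n2; apply: filterS2 => s /=; case: ifP.
rewrite ltxx.
have := @is_derive_glue E (fun s => phi (gmul (c1 s) (ginv (c1 t))))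
  (fun s => phi (gmul (c2 s) (ginv (c2 t)))) t w.
rewrite !lg_mulgV => /(_ erefl dc1 dc2); congr is_derive.
by apply/funext => s; case: ifP; rewrite ?c12.
Qed.
End LieGroupTheory.

Section GlobalFlow.
Variables (R : realType) (n : nat) (G : lieData 'rV[R]_n).
Hypothesis hG : is_lie_group G.
Notation E := 'rV[R]_n.
Notation e := (gone G).

(** Negative integers are reached by running the recursion backwards, through
    the right inverse [g] of [f]. *)
Lemma int_recursion (T : Type) (f : int -> T -> T) (g : int -> T -> T) (x : T) :
  (forall k y, f k (g k y) = y) ->
  exists a : int -> T, a 0 = x /\ forall k, a (k + 1) = f k (a k).
Proof.
move=> fg.
pose an := fix an (i : nat) : T := if i is i'.+1 then f (Posz i') (an i') else x.
pose bn := fix bn (i : nat) : T := if i is i'.+1 then g (Negz i') (bn i') else x.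
exists (fun k => match k with Posz i => an i | Negz i => bn i.+1 end); split=> //.
case=> i; first by rewrite -PoszD addn1.
have -> : Negz i + 1 = - i%:Z by rewrite NegzE -addn1 PoszD opprD subrK.
by rewrite [RHS]/= fg; case: i => [|i]; rewrite -?NegzE.
Qed.

(** Right translation does not change right velocities: on [[k, k + 1]] the
    solution [d k] is translated by the value [a k] reached at time [k]. *)
Lemma rvel_glue_int (w : R -> E) (d : int -> R -> G) :
  (forall k, d k k%:~R = e) ->
  (forall k (t : R), k%:~R <= t <= (k + 1)%:~R -> rvel (d k) t (w t)) ->
  exists c : R -> G, c 0 = e /\ forall t, rvel c t (w t).
Proof.
move=> d1 dv.
have [a [a0 aS]] := @int_recursion G (fun k => gmul (d k (k + 1)%:~R))
  (fun k => gmul (ginv (d k (k + 1)%:~R))) e (fun k y => lg_mulVKg hG _ _).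
exists (fun t => gmul (d (Num.floor t) t) (a (Num.floor t))).
split; first by rewrite floor0 a0 -[X in d _ X](mulr0z 1) d1 lg_mul1g.
move=> t; set k := Num.floor t.
have /andP[kt tk] := floor_itv t; rewrite -/k in kt tk.
have interior (s : R) : k%:~R < s < (k + 1)%:~R ->
    \forall r \near s, Num.floor r = k.
  move=> ks; have /near_in_itvoo : s \in `]k%:~R, (k + 1)%:~R[ by rewrite in_itv.
  apply: filterS => r; rewrite in_itv /= => /andP[kr rk].
  by apply: floor_def; rewrite rk ltW.
have dk (s : R) : k%:~R <= s < (k + 1)%:~R -> rvel (fun s => gmul (d k s) (a k)) s (w s).
  by move=> /andP[ks sk]; apply: rvel_mulr => //; apply: dv; rewrite ks ltW.
move: kt; rewrite le_eqVlt => /orP[/eqP kt|kt]; last first.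
  apply: (near_rvel _ (dk t _)); last by rewrite ltW.
  by have := interior t; rewrite kt tk => /(_ isT); apply: filterS => s ->.
pose l := k - 1; have lk : l + 1 = k by rewrite /l subrK.
have H : rvel (fun s => if s < t then gmul (d l s) (a l) else gmul (d k s) (a k)) t (w t).
  apply: rvel_glue => //.
  - by rewrite -{2}lk aS lk kt -[d k t](_ : e = _) ?lg_mul1g // -kt d1.
  - by apply: rvel_mulr => //; apply: dv; rewrite lk kt lexx andbT -kt ler_int lerBlDr lerDl.
  - by apply: dk; rewrite kt lexx.
apply: (near_rvel _ H).
have : t \in `]l%:~R, (k + 1)%:~R[.
  by rewrite in_itv /= tk andbT -kt ltr_int ltrBlDr ltrDl.
move/near_in_itvoo; apply: filterS => s; rewrite in_itv /= => /andP[ls sk].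
case: ifP => st.
  by rewrite (@floor_def _ s l) // lk kt st ltW.
by rewrite (@floor_def _ s k) // sk kt leNgt st.
Qed.

(** The time of existence [d] of [local_right_flow] is uniform, so after rescaling
    time by [h < d] there is a local solution on every unit interval. *)
Lemma right_flow_bounded (w : R -> E) (B : R) : continuous w ->
  (forall t, `|w t| <= B) -> exists c : R -> G, c 0 = e /\ forall t, rvel c t (w t).
Proof.
move=> cw wB; have B0 : 0 <= B by apply: le_trans (wB 0).
have [d d0 H] := local_right_flow hG B0.
pose h := d / 2; have h0 : 0 < h by rewrite divr_gt0.
have hd : h < d by rewrite /h ltr_pdivrMr // ltr_pMr // ltr1n.
have local (k : int) : {c : R -> G | c 0 = e /\
    forall t, `|t| < d -> rvel c t (w (h * k%:~R + t))}.
  apply/cid/H => // t; apply: continuous_comp; last exact: cw.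
  by apply: continuousD; [exact: cst_continuous|exact: cvg_id].
pose D (k : int) (t : R) := projT1 (local k) (- (h * k%:~R) + h * t).
have [|k t /andP[kt tk]|C [C0 CV]] := @rvel_glue_int (fun t => h *: w (h * t)) D.
- by move=> k; rewrite /D addrC subrr; case: (projT2 (local k)).
- apply: rvel_affine => //; case: (projT2 (local k)) => _ HV.
  have -> : w (h * t) = w (h * k%:~R + (- (h * k%:~R) + h * t)) by rewrite addrA subrr add0r.
  apply: HV.
  rewrite addrC -mulrBr normrM gtr0_norm // ger0_norm ?subr_ge0 //.
  apply: le_lt_trans hd; rewrite -[leRHS]mulr1 ler_pM2l //.
  by move: tk; rewrite intrD mulr1z lerBlDl.
exists (fun s => C (0 + h^-1 * s)); split; first by rewrite mulr0 addr0.
move=> t; have := CV (0 + h^-1 * t) => /(rvel_affine).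
by rewrite add0r !mulVKf ?gt_eqF // scalerA mulVf ?gt_eqF // scale1r.
Qed.

(** On [[k, k + 1]] the field [w] can be replaced by a bounded one, by clamping
    time to [[- (`|k| + 1), `|k| + 1]]. *)
Lemma right_flow (w : R -> E) : continuous w ->
  exists c : R -> G, c 0 = e /\ forall t, rvel c t (w t).
Proof.
move=> cw.
have cc (K : R) : 0 <= K -> continuous (clamp K).
  move=> K0 t; apply/cvgrPdist_lt => eps eps0.
  by exists eps => // s; apply: le_lt_trans; exact: clamp_lip.
have bd (K : R) : 0 <= K -> exists B, forall t, `|w (clamp K t)| <= B.
  move=> K0; have NK : - K <= K by rewrite (le_trans _ K0) // oppr_le0.
  have cn : {within `[- K, K], continuous (fun t => `|w t|)}.
    apply: continuous_subspaceT => t.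
    by apply: (continuous_comp (cw t)); exact: norm_continuous.
  have [t0 _ Ht0] := EVT_max NK cn.
  exists (`|w t0|) => t; apply: Ht0; rewrite in_itv /=.
  by have := clamp_le K0 t; rewrite ler_norml.
pose K (k : int) : R := `|k%:~R| + 1.
have K0 k : 0 <= K k by rewrite addr_ge0.
have flow (k : int) : {c : R -> G | c 0 = e /\ forall t, rvel c t (w (clamp (K k) t))}.
  apply: cid; have [B HB] := bd _ (K0 k); apply: right_flow_bounded HB => t.
  by apply: (continuous_comp (cc _ (K0 k) t)); exact: cw.
pose c k := projT1 (flow k).
have cV k t : rvel (c k) t (w (clamp (K k) t)) by case: (projT2 (flow k)).
apply: (@rvel_glue_int w (fun k t => gmul (c k t) (ginv (c k k%:~R)))).
  by move=> k; rewrite lg_mulgV.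
move=> k t /andP[kt tk]; apply: rvel_mulr => //.
rewrite -[in w t](@clamp_id _ (K k) t) //.
rewrite /K -[t](subrK k%:~R) addrC (le_trans (ler_normD _ _)) // lerD2l.
rewrite ger0_norm ?subr_ge0 //.
by move: tk; rewrite intrD mulr1z lerBlDl.
Qed.
End GlobalFlow.

(** * The left symmetric product of a flat invariant metric *)

Section FlatLieGroup.
Variables (R : realType) (n : nat) (G : lieData 'rV[R]_n) (K : 'M[R]_n).
Variable nabla : (G -> 'rV[R]_n) -> (G -> 'rV[R]_n) -> (G -> 'rV[R]_n).
Variable F : G -> 'M[R]_n.
Hypothesis hG : is_lie_group G.
Hypothesis Ku : K \in unitmx.
Hypothesis hLC : is_levi_civita (bilin K) nabla.
Hypothesis hF : is_rep_integrating F (Lstar nabla).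

Notation E := 'rV[R]_n.
Notation e := (gone G).
Notation phi := (cmap (chart1 G)).
Notation pr := (Lmul nabla).
Notation L := (Lm (Lmul nabla)).
Notation Rr := (Rm (Lmul nabla)).

Lemma smooth_on_cst (V : normedModType R) (D : set G) (x : V) : smooth_on D (cst x : G -> V).
Proof. by move=> c _; exact: smooth_cst. Qed.

Lemma vact_cst x (a : R) g : vact (cst x : G -> E) (cst a) g = 0.
Proof. exact: derive_cst. Qed.

Lemma Lmul_linl a x y z : pr (a *: x + y) z = a *: pr x z + pr y z.
Proof.
have [[_ H _ _] _ _] := hLC.
exact: (H (cst x) (cst y) (cst z) (cst a) (smooth_on_cst _ _) (smooth_on_cst _ _) (smooth_on_cst _ _) (smooth_on_cst _ _)).
Qed.

Lemma Lmul_linr a x y z : pr x (a *: y + z) = a *: pr x y + pr x z.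
Proof.
have [[_ _ H1 H2] _ _] := hLC.
have E1 := H1 (cst x) (cst (a *: y)) (cst z) (smooth_on_cst _ _) (smooth_on_cst _ _) (smooth_on_cst _ _) e.
have E2 := H2 (cst x) (cst y) (cst a) (smooth_on_cst _ _) (smooth_on_cst _ _) (smooth_on_cst _ _) e.
rewrite vact_cst scale0r addr0 in E2.
exact: (etrans E1 (congr1 (fun u => u + _) E2)).
Qed.

(** Compatibility with the metric, evaluated on left invariant fields, whose
    scalar products are constant: [L x] is skew with respect to [K]. *)
Lemma trace_Lm x : \tr (L x) = 0.
Proof.
have bE (M : 'M[R]_n) i j :
    ((delta_mx 0 i : 'rV[R]_n) *m M *m (delta_mx 0 j : 'rV[R]_n)^T) 0 0 = M i j.
  by rewrite -rowE trmx_delta -colE !mxE.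
have skew : L x *m K = - (K *m (L x)^T).
  apply/eqP; rewrite -addr_eq0; apply/eqP/matrixP => i j.
  have [_ _ H] := hLC.
  have := H (cst x) (cst (delta_mx 0 i)) (cst (delta_mx 0 j)) (smooth_on_cst _ _)
    (smooth_on_cst _ _) (smooth_on_cst _ _) e.
  rewrite [LHS](vact_cst x (bilin K (delta_mx 0 i) (delta_mx 0 j)) e).
  rewrite -![nabla _ _ e]/(pr _ _) -!(mul_Lm Lmul_linr) /bilin /cst => /esym.
  set a := delta_mx 0 i; set b := delta_mx 0 j.
  have -> : a *m L x *m K *m b^T = a *m (L x *m K) *m b^T by rewrite !mulmxA.
  have -> : a *m K *m (b *m L x)^T = a *m (K *m (L x)^T) *m b^T by rewrite trmx_mul !mulmxA.
  by rewrite !bE => Eij; rewrite mxE Eij mxE.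
have H : \tr (L x) = - \tr (L x).
  rewrite -{1}(mulmxK Ku (L x)) skew mulNmx linearN /=.
  by rewrite mxtrace_mulC mulmxA mulVmx // mul1mx mxtrace_tr.
by move: (\tr _) H => t; lra.
Qed.

Lemma adM_LR x : adM G x = L x - Rr x.
Proof.
have [_ tf _] := hLC.
apply/row_matrixP => i; rewrite !rowE [RHS]mulmxBr (mul_Lm Lmul_linr) (mul_Rm Lmul_linl).
exact: (adM_bracket hG (tf _ _ (smooth_on_cst _ _) (smooth_on_cst _ _))).
Qed.

Lemma F_mul g h : F (gmul g h) = F g *m F h. Proof. by case: hF. Qed.

Lemma F_unit g : F g \in unitmx. Proof. by case: hF. Qed.

Lemma F_one : F e = 1%:M.
Proof.
by apply: (can_inj (mulKmx (F_unit e))); rewrite mulmx1 -F_mul lg_mul1g.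
Qed.

Lemma F_curve : curve_diff F (fun u => - L u).
Proof.
have [_ _ sF dF] := hF; move=> c t u cc ce dc.
by have := smooth_curve_diff hG sF cc ce dc; rewrite dF.
Qed.

(** The differential of [F] intertwines [Ad g] with the conjugation by [F g]. *)
Lemma Lmul_Ad g y : L (Ad g y) *m F g = F g *m L y.
Proof.
have := hom_conj hG F_curve g y F_mul.
move/(congr1 (fun M => M *m F g)).
by rewrite -mulmxA -F_mul lg_mulVg // F_one mulmx1 mulNmx mulmxN => /oppr_inj.
Qed.

(** Differentiating [Lmul_Ad] at the identity shows that [L] maps brackets to
    commutators, and the bracket is [pr x y - pr y x] by [adM_LR]. *)
Lemma Lmul_lsa x y z : pr x (pr y z) - pr y (pr x z) = pr (pr x y - pr y x) z.
Proof.
have cl := @line_continuous _ _ _ hG x.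
have dl := line_derive hG x.
have l0 := line0 hG x.
have dF := F_curve cl l0 dl; have dA := AdM_curve hG cl l0 dl.
have d1 := is_derive_mulmx (is_derive_Lm Lmul_linl Lmul_linr (is_derive_mulmx (is_derive_cst y (0 : R) (1 : R)) dA)) dF.
have d2 := is_derive_mulmx dF (is_derive_cst (L y) (0 : R) (1 : R)).
have d12 : (fun s => L (cst y s *m (@AdM R n G \o line G x) s) *m (F \o line G x) s) =
   (fun s => (F \o line G x) s *m cst (L y) s).
  by apply/funext => s; rewrite /= (mul_AdM hG) Lmul_Ad.
rewrite d12 in d1; have := is_derive_unique d1 d2.
rewrite /= l0 F_one (AdM1 hG) mulmx0 mul0mx addr0 !mulmx1 add0r adM_LR.
rewrite mulmxBr (mul_Lm Lmul_linr) (mul_Rm Lmul_linl) mulmxN mulNmx.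
move/(congr1 (fun M => z *m M)).
rewrite mulmxDr !mulmxN !mulmxA !(mul_Lm Lmul_linr) => <-.
by rewrite addrC subrK.
Qed.

(** The square of [\det Ad] is constant equal to 1; its derivative at the identity
    in direction [x] is [- 2 \tr (Rr x)]. *)
Lemma unimodular_trace : unimodular G -> forall x, \tr (Rr x) = 0.
Proof.
move=> um x.
have dA := AdM_curve hG (@line_continuous _ _ _ hG x) (line0 hG x) (line_derive hG x).
have := is_deriveX 2 (is_derive_det dA).
have -> : (fun s => \det ((@AdM R n G \o line G x) s) : R^o) ^+ 2 = cst 1.
  apply/funext => s; have /eqP := um (line G x s).
  by rewrite -sqrp_eq1 // real_normK ?num_real // => /eqP.
move=> /is_derive_unique /(_ (is_derive_cst _ _ _)).
rewrite /= (line0 hG) (AdM1 hG) det1 adj1 mulmx1 adM_LR linearB /= trace_Lm sub0r.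
rewrite expr1 mulr1 /GRing.scale /= mulrN => /eqP.
by rewrite oppr_eq0 mulf_eq0 pnatr_eq0 /= => /eqP.
Qed.

Lemma chart_curve_lvel c t a v : {for t, continuous c} -> atlas G a -> cdom a (c t) ->
  is_derive t (1 : R) (cmap a \o c) v -> exists u, lvel c t u.
Proof.
move=> cc aA ac dc.
have d := @gdiff_curve _ _ _ hG (gmul (ginv (c t))) c t a (chart1 G) v cc
  (gdiff_mull hG _ _) aA (atlas_chart1 hG) ac.
rewrite lg_mulVg // in d.
by eexists; split; [exact: cc|exact: (d (cdom_chart1 hG) dc)].
Qed.

(** The derivative of [\det Ad] along any curve is a multiple of the trace of an
    [ad], hence zero. So [\det Ad] is 1 near the identity, locally constant by
    multiplicativity, and constant since paths have connected images. *)
Lemma trace_unimodular : path_connected R G -> (forall x, \tr (Rr x) = 0) -> unimodular G.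
Proof.
move=> pc trR0.
have tr0 x : \tr (adM G x) = 0 by rewrite adM_LR linearB /= trace_Lm trR0 subrr.
have [chi chiE] : {chi : G -> R | forall g, chi g = \det (@AdM R n G g)}.
  by exists (fun g => \det (@AdM R n G g)).
have chiM g h : chi (gmul g h) = chi g * chi h.
  by rewrite !chiE (AdM_mul hG) det_mulmx; exact: mulrC.
have chi1 : chi e = 1 by rewrite chiE (AdM1 hG) det1.
have aA := atlas_chart1 hG.
have near_e : \forall g \near e, chi g = 1.
  have [r /= r0 Hr] := (nbhs_ballP _ _).1 (nbhs_cimg hG aA (cimg_z0 hG)).
  have nb : nbhs (phi e) (ball (phi e) r) by exact: nbhsx_ballx.
  have n1 : \forall g \near e, ball (phi e) r (phi g).
    exact: (cmap_continuous hG aA (cdom_chart1 hG) nb).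
  have n2 := nbhs_cdom hG aA (cdom_chart1 hG).
  move: n1 n2; apply: filterS2 => g bg ag.
  pose v := phi g - phi e.
  have img (s : R) : 0 <= s <= 1 -> cimg (chart1 G) (phi e + s *: v).
    have vr : `|v| < r by move: bg; rewrite -ball_normE /ball_ /= distrC.
    move=> /andP[s0 s1]; apply: Hr; rewrite -ball_normE /ball_ /=.
    rewrite opprD addrA subrr add0r normrN normrZ ger0_norm //.
    by apply: le_lt_trans vr; rewrite ler_piMl.
  have dchi (s : R) : 0 <= s <= 1 -> is_derive s (1 : R) (fun t => chi (line G v t) : R^o) 0.
    move=> /img ims.
    have cs := cdom_cinv hG aA ims.
    have dz := is_derive_line (phi e) v s.
    have cz : {for s, continuous (fun t : R => phi e + t *: v)}.
      by apply/differentiable_continuous/derivable1_diffP; case: dz.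
    have cl : {for s, continuous (line G v)}.
      exact: (continuous_comp cz (cinv_continuous hG aA ims)).
    have dl : is_derive s (1 : R) (phi \o line G v) v.
      apply: near_eq_is_derive dz.
      have : \forall t \near s, cimg (chart1 G) (phi e + t *: v) by exact: (cz _ (nbhs_cimg hG aA ims)).
      by apply: filterS => t at_; rewrite /= /line (cmapK hG aA at_).
    have [u lu] := chart_curve_lvel cl aA cs dl.
    have := is_derive_det (antihom_lvel hG (@AdM_curve _ _ _ hG) (@AdM_mul _ _ _ hG) lu).
    rewrite -mulmxA mul_mx_adj mul_mx_scalar mxtraceZ tr0 mulr0.
    by congr is_derive; apply/funext => t; rewrite chiE.
  have [s _] := @mvt R (fun t => chi (line G v t)) (fun=> 0) 0 1 ler01 dchi.
  rewrite mul0r (line0 hG) chi1 /line scale1r /v (addrC (phi e)) subrK (cinvK hG aA ag).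
  by move/eqP; rewrite subr_eq0 => /eqP.
have local p : \forall g \near p, chi g = chi p.
  have cm : {for p, continuous (fun g => gmul (ginv p) g)} by exact: lg_mull_continuous.
  have nm : nbhs (gmul (ginv p) p) [set g | chi g = 1] by rewrite lg_mulVg.
  have H : \forall g \near p, chi (gmul (ginv p) g) = 1 by exact: (cm _ nm).
  move: H; apply: filterS => g /(congr1 (fun a => chi p * a)).
  by rewrite -chiM (lg_mulVKg hG) mulr1.
move=> g; have [f [cf f0 f1]] := pc e g.
suff : chi g = 1 by rewrite chiE /AdM => ->; rewrite normr1.
have cC : connected (f @` `[0, 1]).
  apply: connected_continuous_connected cf; exact: segment_connected.
have op (b : R -> Prop) : open [set p | b (chi p)].
  rewrite openE => p bp; have := local p; apply: filterS => q /= ->; exact: bp.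
pose B := f @` `[0, 1] `&` [set p | chi p = 1].
have i0 : (0 : R) \in `[0, 1] by rewrite in_itv /= lexx ler01.
have i1 : (1 : R) \in `[0, 1] by rewrite in_itv /= lexx ler01.
(* the points of the path with value 1 are open and closed in its image *)
have BE : B = f @` `[0, 1].
  apply: cC.
  - by exists e; split; [exists 0|].
  - by exists [set p | chi p = 1] => //; exact: (op (fun x => x = 1)).
  - exists [set p | chi p = 1] => //; rewrite -openC.
    exact: (op (fun x => ~ (x = 1))).
by have [_] : B g by rewrite BE; exists 1.
Qed.
(** * Geodesics of the Hess connection *)

Lemma F_lvel c t u : lvel c t u -> is_derive t (1 : R) (F \o c) (- (F (c t) *m L u)).
Proof.
by move=> /(hom_lvel hG F_curve F_mul) d; apply: (is_derive_eq d); rewrite mulmxN.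
Qed.

Lemma invF_lvel c t u : lvel c t u ->
  is_derive t (1 : R) (fun s => invmx (F (c s))) (L u *m invmx (F (c t))).
Proof.
move=> /F_lvel d.
apply: (is_derive_eq (is_derive_invmx (fun s => F_unit (c s)) d)).
by rewrite /= mulmxN mulNmx opprK (mulmxA (invmx _)) mulVmx ?F_unit // mul1mx.
Qed.

(** [v *m F (c t)] solves the Euler equation by [F_lvel].  With
    [S t = 1 + t Rr v], the curve [c] has right velocity [w = v *m invmx (S t)], and
    [AdM (c t) *m S t *m F (c t)] is constant by [Rm_split]; being 1, it identifies
    the left velocity [w *m invmx (AdM (c t))] with [v *m F (c t)]. *)
Lemma Euler_solution v : (forall x, \tr (Rr x) = 0) ->
  exists c : R -> G, c 0 = e /\ forall t, lvel c t (v *m F (c t)).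
Proof.
move=> trR0.
pose S (t : R) := 1%:M + t *: Rr v.
have Su t : S t \in unitmx.
  by rewrite unitmxE (det_1DRm Lmul_linl Lmul_linr Lmul_lsa trR0) unitr1.
have dS t : is_derive t (1 : R) S (Rr v) by exact: is_derive_line.
pose w t := v *m invmx (S t).
have cw : continuous w.
  move=> t; apply/differentiable_continuous/derivable1_diffP.
  by case: (is_derive_mulmx (is_derive_cst v t (1 : R)) (is_derive_invmx Su (dS t))).
have [c [c0 cV]] := right_flow hG cw.
exists c; split=> // t.
pose A t := @AdM R n G (c t).
have X1 s : A s *m S s *m F (c s) = 1%:M.
  have dX r : is_derive r (1 : R) (fun s => A s *m S s *m F (c s)) 0.
    have dA : is_derive r (1 : R) A (A r *m (L (w r) - Rr (w r))).
      by rewrite -adM_LR; exact: (antihom_rvel hG (@AdM_curve _ _ _ hG) (@AdM_mul _ _ _ hG) (cV r)).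
    have dF := hom_rvel hG F_curve F_mul (cV r).
    apply: (is_derive_eq (is_derive_mulmx (is_derive_mulmx dA (dS r)) dF)).
    have wS : w r + r *: pr (w r) v = v.
      have : w r *m S r = v by rewrite /w mulmxKV.
      by rewrite mulmxDr mulmx1 -scalemxAr (mul_Rm Lmul_linl).
    have fact (X D T V P Q : 'M[R]_n) : (X *m D *m T + X *m V) *m P + X *m T *m (- Q *m P)
        = X *m (D *m T + V - T *m Q) *m P.
      by rewrite mulNmx mulmxN mulmxBr mulmxDr mulmxBl !mulmxA.
    rewrite [LHS]fact mulmxBl (Rm_split Lmul_linl Lmul_linr Lmul_lsa wS) -/(S r).
    move: (S r *m L (w r)) (L (w r) *m S r) (Rr (w r) *m S r) => a b d.
    have -> : b - d + (a - b + d) - a = 0.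
      by apply/matrixP => i j; rewrite !mxE; ring.
    by rewrite mulmx0 mul0mx.
  by rewrite (mx_cst_of_deriv0 dX) /A c0 (AdM1 hG) F_one /S scale0r addr0 !mulmx1.
have -> : v *m F (c t) = Ad (ginv (c t)) (w t).
  rewrite -(mul_AdM hG) -[RHS]mulmx1 -(X1 t) !mulmxA -(mulmxA (w t)).
  by rewrite -(AdM_mul hG) (lg_mulgV hG) (AdM1 hG) mulmx1 /w mulmxKV.
exact: rvel_lvel.
Qed.

Section Cotangent.
Variable nablaH : (cotangent F -> 'rV[R]_n * 'cV[R]_n) ->
            (cotangent F -> 'rV[R]_n * 'cV[R]_n) ->
            (cotangent F -> 'rV[R]_n * 'cV[R]_n).
Hypothesis hH : is_hess_connection nabla nablaH.

Lemma hess_cst (u : 'rV[R]_n * 'cV[R]_n) p :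
  nablaH (cst u) (cst u) p = (pr u.1 u.1, - (L u.1 *m u.2)).
Proof. by case: u => x b; case: hH => _ ->; rewrite /cst /Lstar mulNmx. Qed.

(** The fibre component of a product is an affine function of that of the second
    argument, with linear part [F p.1]. *)
Lemma lderiv_cotangent (p : cotangent F) (u : 'rV[R]_n * 'cV[R]_n) a :
  atlas G a -> cdom a p.1 ->
  lderiv p u (cmap (@cotangent_chart R n G a)) = (lderiv p.1 u.1 (cmap a), F p.1 *m u.2).
Proof.
case: p u => [g a0] [x b] aA ac.
have d1 : is_derive (phi e) x (fun z => cmap a (gmul g (cinv (chart1 G) z))) (lderiv g x (cmap a)).
  apply: derivableP; apply: diff_derivable.
  have [_ /(_ (chart1 G) a (atlas_chart1 hG) aA (cdom_chart1 hG))] := gdiff_mull hG g e.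
  by rewrite (lg_mulg1 hG) => /(_ ac).
have d2 : is_derive (0 : 'cV[R]_n) b (fun z => F g *m z + a0) (F g *m b).
  have := is_deriveD (is_derive_mulmx (is_derive_cst (F g) (0 : 'cV[R]_n) b)
    (is_derive_id (0 : 'cV[R]_n) b)) (is_derive_cst a0 (0 : 'cV[R]_n) b).
  by rewrite mul0mx add0r addr0.
by case: (is_derive_pair (is_derive_on_fst 0 b d1) (is_derive_on_snd (phi e) x d2)) => _ <-.
Qed.

(** Over the curve of [Euler_solution] the fibre component of the velocity is
    [invmx (F (c t)) *m b]; it is cancelled by the factor [F (g0 c)] of the product,
    so that the fibre component of the geodesic is affine in [t]. *)
Lemma unimodular_complete : unimodular G -> geodesically_complete nablaH.
Proof.
move=> um [g0 a0] [v b]; have trR0 := unimodular_trace um.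
have [c [c0 cV]] := Euler_solution v trR0.
pose C (t : R) : cotangent F := (gmul g0 (c t), a0 + t *: (F g0 *m b)).
pose W (t : R) : 'rV[R]_n * 'cV[R]_n := (v *m F (c t), invmx (F (c t)) *m b).
have dW t : is_derive t (1 : R) W
    (- pr (v *m F (c t)) (v *m F (c t)), L (v *m F (c t)) *m (invmx (F (c t)) *m b)).
  apply: is_derive_pair.
    apply: (is_derive_eq (is_derive_mulmx (is_derive_cst v t (1 : R)) (F_lvel (cV t)))).
    by rewrite mul0mx add0r mulmxN mulmxA (mul_Lm Lmul_linr).
  apply: (is_derive_eq (is_derive_mulmx (invF_lvel (cV t)) (is_derive_cst b t (1 : R)))).
  by rewrite mulmx0 addr0 mulmxA.
exists C, W; split; last 2 first.
- by rewrite /C c0 scale0r addr0 (lg_mulg1 hG).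
- by rewrite /W c0 F_one invmx1 mulmx1 mul1mx.
split.
- have cV' t := lvel_mull hG g0 (cV t).
  split=> [t|t _ [a aA <-] [/= ac _]].
    have c1 : {for t, continuous (fun t => gmul g0 (c t))} by case: (cV' t).
    have c2 : {for t, continuous (fun t : R => a0 + t *: (F g0 *m b))}.
      apply/differentiable_continuous/derivable1_diffP.
      by case: (is_derive_line a0 (F g0 *m b) t).
    exact: (cvg_pair c1 c2).
  rewrite lderiv_cotangent //=; apply: is_derive_pair.
    exact: (lvel_chart hG (cV' t) aA ac).
  have := is_derive_line a0 (F g0 *m b) t.
  by rewrite F_mul mulmxA mulmxK ?F_unit.
- by move=> t; case: (dW t).
- move=> t; rewrite /covariant_acceleration hess_cst; case: (dW t) => _ ->.
  by congr (_, _); rewrite /= ?addNr ?subrr.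
Qed.

(** Along the geodesic with initial velocity [v], [invmx (AdM c) *m invmx (F c)] has
    derivative [Rr v] by the equivariance [Lmul_Ad], so it is [1 + t Rr v]; at time
    1 this shows that [1 + Rr v] is invertible. *)
Lemma complete_trace : geodesically_complete nablaH -> forall x, \tr (Rr x) = 0.
Proof.
move=> gc; apply: (trace_Rm_eq0 Lmul_linl Lmul_linr Lmul_lsa) => v.
have [C [W [[hv dW acc] C0 W0]]] := gc (e, 0) (v, 0).
pose c t : G := (C t).1; pose u t := (W t).1.
have cV t : lvel c t (u t).
  have [cC dC] := hv.
  have cc : {for t, continuous c}.
    have c1 : {for C t, continuous (fun z : G * 'cV[R]_n => z.1)}.
      by case: (C t) => ? ?; exact: cvg_fst.
    exact: (continuous_comp (cC t) c1).
  have [a aA ac] := exists_chart hG (c t).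
  apply: (chart_lvel hG cc aA ac).
  have aC : atlas (cotangent F) (@cotangent_chart R n G a) by exists a.
  have := is_derive_fst (dC t _ aC (conj ac I)).
  by rewrite lderiv_cotangent.
have du t : is_derive t (1 : R) u (- (u t *m L (u t))).
  have d := is_derive_fst (derivableP (dW t)).
  apply: (is_derive_eq d); have /(congr1 fst) := acc t.
  rewrite /covariant_acceleration hess_cst /= => /eqP.
  by rewrite addr_eq0 (mul_Lm Lmul_linr) => /eqP.
have c0 : c 0 = e by rewrite /c C0.
have u0 : u 0 = v by rewrite /u W0.
pose A t := @AdM R n G (c t); pose iF t := invmx (F (c t)).
have Au t : A t \in unitmx by exact: AdM_unit.
have diF t : is_derive t (1 : R) iF (L (u t) *m iF t) by exact: invF_lvel.
have uF t : u t *m iF t = v.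
  have d r : is_derive r (1 : R) (fun t => u t *m iF t) 0.
    apply: (is_derive_eq (is_derive_mulmx (du r) (diF r))).
    by rewrite mulNmx mulmxA addNr.
  by rewrite (mx_cst_of_deriv0 d) u0 /iF c0 F_one invmx1 mulmx1.
pose T t := invmx (A t) *m iF t.
have dT t : is_derive t (1 : R) T (Rr v).
  have dA : is_derive t (1 : R) A ((L (u t) - Rr (u t)) *m A t).
    by rewrite -adM_LR; exact: (antihom_lvel hG (@AdM_curve _ _ _ hG) (@AdM_mul _ _ _ hG) (cV t)).
  apply: (is_derive_eq (is_derive_mulmx (is_derive_invmx Au dA) (diF t))).
  rewrite -(mulmxA _ _ (invmx (A t))) mulmxK // mulNmx -mulmxA.
  rewrite addrC -mulmxBr -mulmxBl opprB addrC subrK.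
  apply/row_matrixP => i; rewrite !rowE !mulmxA (mul_Rm Lmul_linl) (mul_Rm Lmul_linl).
  set x := delta_mx 0 i.
  have := Lmul_Ad (c t) (x *m invmx (A t)).
  rewrite -(mul_AdM hG) mulmxKV // => /(congr1 (fun M => v *m M *m iF t)).
  rewrite !mulmxA mulmxK ?F_unit // (mul_Lm Lmul_linr) => ->.
  by rewrite -[in RHS](uF t) mulmxKV ?F_unit // (mul_Lm Lmul_linr).
have TE : T 1 = 1%:M + 1 *: Rr v.
  have d r : is_derive r (1 : R) (fun t => T t - (1%:M + t *: Rr v)) 0.
    by apply: (is_derive_eq (is_deriveB (dT r) (is_derive_line 1%:M (Rr v) r))); rewrite subrr.
  apply/eqP; rewrite -subr_eq0 (mx_cst_of_deriv0 d) scale0r addr0.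
  by rewrite /T /A /iF c0 (AdM1 hG) F_one invmx1 mulmx1 subrr.
rewrite -[Rr v]scale1r -TE -unitfE -unitmxE /T unitmx_mul !unitmx_inv Au.
exact: F_unit.
Qed.

End Cotangent.
End FlatLieGroup.

Theorem corollary3p5 (R : realType) (n : nat) (G : lieData 'rV[R]_n)
    (K : 'M[R]_n)
    (nabla : (G -> 'rV[R]_n) -> (G -> 'rV[R]_n) -> (G -> 'rV[R]_n))
    (F : G -> 'M[R]_n)
    (nablaH : (cotangent F -> 'rV[R]_n * 'cV[R]_n) ->
              (cotangent F -> 'rV[R]_n * 'cV[R]_n) ->
              (cotangent F -> 'rV[R]_n * 'cV[R]_n)) :
  is_lie_group G ->
  simply_connected R G ->
  K^T = K -> K \in unitmx ->
  is_levi_civita (bilin K) nabla ->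
  flat nabla ->
  is_rep_integrating F (Lstar nabla) ->
  is_hess_connection nabla nablaH ->
  (geodesically_complete nablaH <-> unimodular G).
Proof.
move=> hG [pc _] _ Ku hLC _ hF hH; split=> [gc|um].
  apply: (trace_unimodular hG Ku hLC pc).
  exact: (complete_trace hG hLC hF hH gc).
exact: (unimodular_complete hG Ku hLC hF hH um).
Qed.
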